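(* Let $\lambda\ge0$ and consider the system $$S'=-\tfrac{1}{3\sqrt3}-\tfrac23S+\tfrac1{\sqrt3}S^2+\tfrac1{\sqrt3}U^2+\tfrac1{2\sqrt3}P^2+2S^3-SU^2+SP^2,$$ $$U'=U\bigl(\tfrac13-\tfrac\lambda2P+2S^2-U^2+P^2\bigr),\qquad P'=-\tfrac23P+\lambda U^2+2S^2P-U^2P+P^3 .$$ At its critical point $$P_3=(S,U,P)=\Bigl(\tfrac1{2\sqrt3}\tfrac{2-\lambda^2}{\lambda^2+1},\ \tfrac{\sqrt{\lambda^2+2}}{\sqrt2(\lambda^2+1)},\ \tfrac{\lambda}{\lambda^2+1}\Bigr)$$ the linearization has eigenvalues $$\varepsilon_1=-\frac{\lambda^2+2}{2(\lambda^2+1)},\qquad \varepsilon_{2,3}=\frac{-(\lambda^2+2)\pm\sqrt{(18-7\lambda^2)(\lambda^2+2)}}{4(\lambda^2+1)} .$$ For $\tau\to\infty$, $P_3$ is unstable if $\lambda\le\sqrt2$ and asymptotically stable if $\lambda>\sqrt2$.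
   Context: The prime denotes $d/d\tau$; stability and asymptotic stability are in the sense of Lyapunov, in $\mathbb{R}^3$ with coordinates $(S,U,P)$. For $\lambda>\sqrt{18/7}$ the square root is understood as a complex square root. *)

(* Defs.v *)
From HB Require Import structures.
From mathcomp Require Import all_boot all_order all_algebra.
From mathcomp Require Import complex.
From mathcomp Require Import all_classical all_reals all_analysis.

Set Implicit Arguments.
Unset Strict Implicit.
Unset Printing Implicit Defensive.

Import Order.TTheory GRing.Theory Num.Theory.
Import numFieldNormedType.Exports.

Local Open Scope classical_set_scope.
Local Open Scope ring_scope.

(* Forward-global solutions of x' = f(x).  Values at negative times are
   irrelevant; since f is continuous, continuity on [0, +oo[ together with the
   equation on ]0, +oo[ gives the right derivative f (x 0) at time 0. *)
Definition forward_solution (R : realType) (V : normedModType R)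
    (f : V -> V) (x : R -> V) : Prop :=
  {within `[0, +oo[, continuous x} /\
  forall t : R, 0 < t -> is_derive t 1 x (f (x t)).

(* Global existence for nearby initial data is part of stability, so that the
   condition on all solutions cannot hold vacuously.  Conversely, for locally
   Lipschitz f in finite dimension, a maximal solution that is not defined for
   all t >= 0 leaves every ball, so the negation of [lyapunov_stable] is the
   usual instability. *)
Definition lyapunov_stable (R : realType) (V : normedModType R)
    (f : V -> V) (p : V) : Prop :=
  forall e : R, 0 < e -> exists2 d : R, 0 < d &
    forall x0 : V, `|x0 - p| < d ->
      (exists2 x : R -> V, forward_solution f x & x 0 = x0) /\
      (forall x : R -> V, forward_solution f x -> x 0 = x0 ->
         forall t : R, 0 <= t -> `|x t - p| < e).

Definition unstable (R : realType) (V : normedModType R)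
    (f : V -> V) (p : V) : Prop := ~ lyapunov_stable f p.

Definition asymptotically_stable (R : realType) (V : normedModType R)
    (f : V -> V) (p : V) : Prop :=
  lyapunov_stable f p /\
  exists2 d : R, 0 < d &
    forall x : R -> V, forward_solution f x -> `|x 0 - p| < d ->
      x t @[t --> +oo] --> p.

(* R^3 carries the sup norm of matrices; all norms being equivalent, the
   stability notions do not depend on this choice. *)
Definition row3 (R : realType) (a b c : R) : 'rV[R]_3 :=
  \row_(i < 3) [:: a; b; c]`_i.

Definition SUP_field (R : realType) (l : R) (x : 'rV[R]_3) : 'rV[R]_3 :=
  let S := x 0 0 in let U := x 0 1 in let P := x 0 2 in
  let r3 := Num.sqrt 3 in
  row3
    (- (1 / (3 * r3)) - 2 / 3 * S + 1 / r3 * S ^+ 2 + 1 / r3 * U ^+ 2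
       + 1 / (2 * r3) * P ^+ 2 + 2 * S ^+ 3 - S * U ^+ 2 + S * P ^+ 2)
    (U * (1 / 3 - l / 2 * P + 2 * S ^+ 2 - U ^+ 2 + P ^+ 2))
    (- (2 / 3) * P + l * U ^+ 2 + 2 * S ^+ 2 * P - U ^+ 2 * P + P ^+ 3).

Definition P3 (R : realType) (l : R) : 'rV[R]_3 :=
  row3
    (1 / (2 * Num.sqrt 3) * ((2 - l ^+ 2) / (l ^+ 2 + 1)))
    (Num.sqrt (l ^+ 2 + 2) / (Num.sqrt 2 * (l ^+ 2 + 1)))
    (l / (l ^+ 2 + 1)).

(* The Jacobian matrix with complex entries.  ['J f p] acts on row vectors,
   v *m 'J f p = 'd f p v, i.e. it is the transpose of the matrix of partial
   derivatives usually written, which has the same eigenvalues. *)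
Definition linearization (R : realType) (n : nat)
    (f : 'rV[R]_n -> 'rV[R]_n) (p : 'rV[R]_n) : 'M[complex R]_n :=
  map_mx (real_complex R) (jacobian f p).

Definition eps1 (R : realType) (l : R) : complex R :=
  let c : complex R := real_complex R l in
  - ((c ^+ 2 + 2) / (2 * (c ^+ 2 + 1))).

Definition eps2 (R : realType) (l : R) : complex R :=
  let c : complex R := real_complex R l in
  (- (c ^+ 2 + 2) + sqrtC ((18 - 7 * c ^+ 2) * (c ^+ 2 + 2)))
    / (4 * (c ^+ 2 + 1)).

Definition eps3 (R : realType) (l : R) : complex R :=
  let c : complex R := real_complex R l in
  (- (c ^+ 2 + 2) - sqrtC ((18 - 7 * c ^+ 2) * (c ^+ 2 + 2)))
    / (4 * (c ^+ 2 + 1)).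

(* Main.v *)
(** In the coordinates (with kappa = 2 S^2 - U^2 + P^2 - 2/3)

      y = 2 sqrt3 l S - 3 P + l,    G = 2/3 - l P - (2/3) sqrt3 S,
      z = (2 - l^2)/2 U^2 - (S^2 + U^2 + P^2/2 - 1/3),

    which all vanish at P3, the system reads exactly

      y' = kappa y,    G' = kappa G + 2 z,    z' = a z + W G

    with W = (2 - l^2)/2 U^2.  At P3, kappa is negative and a vanishes, so the
    sign of 2 - l^2 decides: if it is positive, (G, z) is a saddle, and a
    quadratic form in (G, z) is a Chetaev function; if it is negative,
    (G, z) is a damped oscillator with a quadratic Lyapunov function.  If
    l^2 = 2, then W = 0 and z' = - 3 z^2 + ... along the center direction
    y = 0, G = 3 z, so that - z - 2 (y^2 + (G - 3 z)^2) is a Chetaev function.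

    Stability includes global existence near P3: the field is composed with a
    clipping to a box around P3, which makes it globally Lipschitz, and the
    Lyapunov function confines the Picard solutions of the clipped field to a
    ball where both fields agree. *)

Require Import Defs.
From HB Require Import structures.
From mathcomp Require Import all_boot all_order all_algebra.
From mathcomp Require Import complex.
From mathcomp Require Import all_classical all_reals all_analysis.
From mathcomp Require Import ring lra.

Set Implicit Arguments.
Unset Strict Implicit.
Unset Printing Implicit Defensive.

Import Order.TTheory GRing.Theory Num.Theory.
Import numFieldNormedType.Exports.

Local Open Scope classical_set_scope.
Local Open Scope ring_scope.

(** * Global solutions of Lipschitz equations *)

(** The integral starts at -1, so that the fundamental theorem of calculus covers a neighbourhood of
    0. Composing with [Num.max t 0] then makes the primitive continuous on the whole line. *)
Lemma continuous_primitive (R : realType) (h : R -> R) : continuous h ->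
  exists F : R -> R, [/\ continuous F, F 0 = 0 &
    forall t : R, 0 < t -> is_derive t 1 F (h t)].
Proof.
move=> ch.
pose mu := @lebesgue_measure R.
pose F0 := fun x : R => (\int[mu]_(t in [set` `[-1, x]]) (h t))%R.
have F0d (x : R) : -1 < x -> is_derive x 1 F0 (h x).
  move=> x1; have [] := @continuous_FTC1_closed R h (-1) x (x + 1) _ _ x1 (ch x).
  - by rewrite ltrDl.
  - apply: continuous_compact_integrable; first exact: segment_compact.
    by apply: continuous_subspaceT => ?; exact: ch.
  - by move=> dF eF; rewrite -eF derive1E; apply: derivableP.
pose m0 := fun t : R => Num.max t 0.
have cm : continuous m0.
  by move=> t; apply: continuous_max; [exact: cvg_id|exact: cvg_cst].
exists (fun t => F0 (m0 t) - F0 0); split.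
- move=> t; apply: cvgB; last exact: cvg_cst.
  apply: (@cvg_comp _ _ _ m0 F0); first exact: cm.
  apply: differentiable_continuous; apply/derivable1_diffP.
  have H : -1 < m0 t by rewrite (@lt_le_trans _ _ 0)// /m0 le_max lexx orbT.
  by have [] := F0d _ H.
- by rewrite /m0 maxxx subrr.
- move=> t t0.
  have nearF : \near t, F0 t - F0 0 = F0 (m0 t) - F0 0.
    by near=> s; rewrite /m0 max_l// ltW//; near: s; exact: lt_nbhsr.
  apply: (near_eq_is_derive nearF); rewrite -[h t]subr0.
  apply: is_deriveB; apply: F0d.
  by rewrite (lt_trans _ t0)// ltrN10.
Unshelve. all: by end_near. Qed.

Lemma is_derive_mxP (R : realFieldType) (V : normedModType R) m n
    (M : V -> 'M[R]_(m, n)) (D : 'M[R]_(m, n)) (t v : V) :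
  is_derive t v M D <->
  forall i j, is_derive t v (fun x => M x i j) (D i j).
Proof.
split=> [[dM <-] i j|dM].
  have /derivable_mxP dMij := dM; rewrite derive_mx// mxE.
  exact/derivableP/dMij.
have dM' : derivable M t v by apply/derivable_mxP => i j; case: (dM i j).
apply: DeriveDef => //; rewrite derive_mx//; apply/matrixP => i j.
by rewrite mxE; case: (dM i j).
Qed.

Lemma coord_le_norm (R : realFieldType) m n (x : 'M[R]_(m, n)) i j :
  `|x i j| <= `|x|.
Proof.
rewrite [leRHS]/Num.Def.normr/= mx_normrE.
exact: (le_bigmax _ (fun ij => `|x ij.1 ij.2|) (i, j)).
Qed.

Lemma norm_le_coord (R : realFieldType) m n (x : 'M[R]_(m, n)) (b : R) :
  0 <= b -> (forall i j, `|x i j| <= b) -> `|x| <= b.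
Proof.
move=> b0 xb; rewrite [leLHS]/Num.Def.normr/= mx_normrE.
by apply: bigmax_le => // -[i j] _; exact: xb.
Qed.

Lemma continuous_mxP (T : topologicalType) (R : realFieldType) m n
    (M : T -> 'M[R]_(m, n)) :
  (forall i j, continuous (fun x => M x i j)) -> continuous M.
Proof.
move=> cM t; apply/cvgrPdist_le => e e0.
have : \forall s \near t, forall ij : 'I_m * 'I_n,
    `|M t ij.1 ij.2 - M s ij.1 ij.2| <= e.
  apply: filter_forall => -[i j] /=.
  by move/cvgrPdist_le : (cM i j t) => /(_ _ e0).
apply: filterS => s Hs; apply: norm_le_coord; first exact: ltW.
by move=> i j; rewrite !mxE; exact: (Hs (i, j)).
Qed.

(** For s = 1 and s = -1, the function K / c exp(c t) - s u(t) has nonnegative derivative at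
    positive times and the value K / c >= 0 at time 0. *)
Lemma norm_le_expR_of_derive (R : realType) (u u' : R -> R) (K c : R) :
  0 <= K -> 0 < c -> continuous u -> u 0 = 0 ->
  (forall t : R, 0 < t -> is_derive t 1 u (u' t)) ->
  (forall t : R, 0 < t -> `|u' t| <= K * expR (c * t)) ->
  forall t, 0 <= t -> `|u t| <= K / c * expR (c * t).
Proof.
move=> K0 c0 cu u0 du u'le.
have key (s : R) : `|s| <= 1 -> forall t, 0 <= t -> s * u t <= K / c * expR (c * t).
  move=> s1 t t0.
  pose w t := K / c * expR (c * t) - s * u t.
  have dw (r : R) : 0 < r -> is_derive r 1 w (K * expR (c * r) - s * u' r).
    move=> r0; have dur := du _ r0; rewrite /w.
    have dcr : is_derive r 1 (fun r : R => c * r) c.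
      by apply: is_derive_eq; rewrite scaler1.
    have := @is_derive1_comp _ expR _ _ _ _ (is_derive_expR _) dcr.
    rewrite /comp => de.
    have -> : K * expR (c * r) = K / c * (expR (c * r) * c).
      by rewrite -mulrA [_ * c]mulrC mulKf// gt_eqF.
    apply: is_deriveB; exact: is_deriveZ.
  have cw : continuous w.
    move=> r; apply: cvgB; (apply: cvgM; first exact: cvg_cst); last exact: cu.
    apply: (@cvg_comp _ _ _ (fun r => c * r) expR); last exact: continuous_expR.
    by apply: cvgM; [exact: cvg_cst|exact: cvg_id].
  have : w 0 <= w t.
    apply: (@ger0_derive1_ndecry _ w 0 _ _ _ 0 t (lexx 0) t0).
    - by move=> r; rewrite in_itv/= andbT => /dw[].
    - move=> r; rewrite in_itv/= andbT => r0; have [_ dwr] := dw _ r0.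
      rewrite derive1E dwr subr_ge0 (le_trans (ler_norm _))// normrM.
      by rewrite (le_trans _ (u'le _ r0))// ler_piMl.
    - exact: continuous_subspaceT.
  rewrite /w mulr0 u0 mulr0 subr0 expR0 mulr1 => w0t.
  rewrite -subr_ge0 (le_trans _ w0t)// divr_ge0// ltW//.
move=> t t0; rewrite ler_norml; apply/andP; split; last first.
  by have := key 1 _ t t0; rewrite normr1 mul1r; apply.
by rewrite lerNl; have := key (-1) _ t t0; rewrite normrN1 mulN1r; apply.
Qed.

(* The limit is the supremum of the increasing minorants [u n - C * 2 / 2 ^ n]. *)
Lemma geometric_limit (R : realType) (u : nat -> R) (C : R) : 0 <= C ->
  (forall n, `|u n.+1 - u n| <= C / 2 ^+ n) ->
  exists l, forall n, `|l - u n| <= C * 2 / 2 ^+ n.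
Proof.
move=> C0 uC.
have p2 n : 0 < (2 : R) ^+ n by rewrite exprn_gt0.
have halve n : C * 2 / 2 ^+ n = C / 2 ^+ n + C * 2 / 2 ^+ n.+1.
  have := p2 n; rewrite exprS => p2n; field.
  by rewrite gt_eqF.
pose v n := u n - C * 2 / 2 ^+ n; pose w n := u n + C * 2 / 2 ^+ n.
have vS n : v n <= v n.+1.
  by have := uC n; rewrite /v halve ler_norml => /andP[]; lra.
have wS n : w n.+1 <= w n.
  by have := uC n; rewrite /w (halve n) ler_norml => /andP[]; lra.
have v_homo : {homo v : n m / (n <= m)%N >-> n <= m}.
  by apply: homo_leq => // ? ? ?; apply: le_trans.
have w_homo : {homo w : n m / (n <= m)%N >-> m <= n}.
  by apply: (homo_leq (r := fun x y => y <= x)) => // ? ? ? ? /le_trans; apply.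
have vw n m : v n <= w m.
  have vwk k : v k <= w k.
    rewrite /v /w; have : 0 <= C * 2 / 2 ^+ k by rewrite divr_ge0 ?mulr_ge0// ltW.
    lra.
  rewrite (le_trans (v_homo _ _ (leq_maxl n m)))// (le_trans (vwk _))//.
  by rewrite w_homo// leq_maxr.
exists (sup (range v)) => n; rewrite ler_norml; apply/andP; split.
  have : v n <= sup (range v).
    by apply: ub_le_sup; [exists (w 0%N) => _ [k _ <-]|exists n].
  rewrite /v; lra.
have : sup (range v) <= w n.
  by apply: ge_sup; [exists (v 0%N), 0%N|move=> _ [k _ <-]].
rewrite /w; lra.
Qed.

Lemma lipschitz_bound_continuous (R : realFieldType) (V W : normedModType R)
    (g : V -> W) (L : R) : 0 <= L ->
  (forall x y, `|g x - g y| <= L * `|x - y|) -> continuous g.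
Proof.
move=> L0 g_lip x; apply/cvgrPdist_le => e e0.
have L1 : 0 < L + 1 by rewrite ltr_wpDl.
near=> y; rewrite (le_trans (g_lip _ _))//.
rewrite (@le_trans _ _ ((L + 1) * `|x - y|))//.
  by rewrite ler_wpM2r// lerDl.
rewrite mulrC -ler_pdivlMr//.
by near: y; apply: cvgr_dist_le; [exact: cvg_id|rewrite divr_gt0].
Unshelve. all: by end_near. Qed.

Section Picard.
Variables (R : realType) (n : nat) (g : 'rV[R]_n -> 'rV[R]_n) (L : R).
Hypothesis L0 : 0 <= L.
Hypothesis g_lip : forall x y, `|g x - g y| <= L * `|x - y|.
Variable x0 : 'rV[R]_n.

Let V := 'rV[R]_n.
Let c := 2 * (L + 1).

Let c0 : 0 < c. Proof. by rewrite mulr_gt0// ltr_wpDl. Qed.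

Let g_cont : continuous g.
Proof. exact: (@lipschitz_bound_continuous _ _ _ _ L). Qed.

(** The Picard relation Y(t) = x0 + int_0^t g(X), put as an initial value and a derivative so that
    no vector-valued integral is needed. *)
Let step (X Y : R -> V) := [/\ continuous Y, Y 0 = x0 &
  forall t : R, 0 < t -> is_derive t 1 Y (g (X t))].

Let step_exists (X : R -> V) : continuous X -> exists Y, step X Y.
Proof.
move=> cX.
have /choice[F F_prop] : forall j : 'I_n, exists F : R -> R,
    [/\ continuous F, F 0 = 0 &
      forall t : R, 0 < t -> is_derive t 1 F (g (X t) 0 j)].
  move=> j; apply: (@continuous_primitive R (fun t => g (X t) 0 j)) => t.
  apply: (@cvg_comp _ _ _ (g \o X) (fun M : V => M 0 j)).
    by apply: (@cvg_comp _ _ _ X g); [exact: cX|exact: g_cont].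
  exact: coord_continuous.
exists (fun t => \row_j (x0 0 j + F j t)); split.
- apply: continuous_mxP => i j t.
  have [cF _ _] := F_prop j.
  rewrite (_ : (fun _ => _) = fun s => x0 0 j + F j s); last first.
    by apply/funext => s; rewrite mxE.
  by apply: cvgD; [exact: cvg_cst|exact: cF].
- by apply/rowP => j; have [_ F0 _] := F_prop j; rewrite mxE F0 addr0.
- move=> t t0; apply/is_derive_mxP => i j; rewrite ord1.
  have [_ _ /(_ _ t0) dF] := F_prop j.
  rewrite (_ : (fun _ => _) = fun s => x0 0 j + F j s); last first.
    by apply/funext => s; rewrite mxE.
  by rewrite -[X in is_derive _ _ _ X]add0r; apply: is_deriveD.
Qed.

(** Each coordinate of Y1 - Y2 has derivative at most L B exp(c t); integrating the exponential
    divides by c, and L / c <= 1/2. *)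
Let step_contract (X1 X2 Y1 Y2 : R -> V) (B : R) : 0 <= B ->
  step X1 Y1 -> step X2 Y2 ->
  (forall t, 0 <= t -> `|X1 t - X2 t| <= B * expR (c * t)) ->
  forall t, 0 <= t -> `|Y1 t - Y2 t| <= B / 2 * expR (c * t).
Proof.
move=> B0 [cY1 Y10 dY1] [cY2 Y20 dY2] XB t t0.
have L_half : L * B / c <= B / 2.
  rewrite ler_pdivrMr// /c (_ : B / 2 * _ = B * (L + 1)); last by field.
  by rewrite mulrC ler_wpM2l// lerDl.
rewrite (@le_trans _ _ (L * B / c * expR (c * t)))//; last first.
  by rewrite ler_wpM2r// expR_ge0.
have LB0 : 0 <= L * B by rewrite mulr_ge0.
apply: norm_le_coord.
  by rewrite mulr_ge0 ?expR_ge0// divr_ge0// ltW.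
move=> i j; rewrite ord1 !mxE.
apply: (@norm_le_expR_of_derive _ (fun s => Y1 s 0 j - Y2 s 0 j)
  (fun s => g (X1 s) 0 j - g (X2 s) 0 j)) => //.
- have cc (Y : R -> V) : continuous Y -> continuous (fun s => Y s 0 j).
    move=> cY s; apply: (@cvg_comp _ _ _ Y (fun M : V => M 0 j)); first exact: cY.
    exact: coord_continuous.
  by move=> s; apply: cvgB; apply: cc.
- by rewrite Y10 Y20 subrr.
- move=> s s0; have /is_derive_mxP/(_ 0 j) d1 := dY1 _ s0.
  have /is_derive_mxP/(_ 0 j) d2 := dY2 _ s0.
  exact: is_deriveB.
- move=> s s0; rewrite (_ : _ - _ = (g (X1 s) - g (X2 s)) 0 j); last by rewrite !mxE.
  rewrite (le_trans (coord_le_norm _ _ _))// (le_trans (g_lip _ _))// -mulrA.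
  by rewrite ler_wpM2l// XB// ltW.
Qed.

(* The weight [expR (c * t)] with [c > 2 L] makes the Picard operator a
   contraction of ratio 1/2 on the whole half-line. *)
Lemma lipschitz_global_solution : exists x : R -> V,
  [/\ continuous x, x 0 = x0 &
    forall t : R, 0 < t -> is_derive t 1 x (g (x t))].
Proof.
(* A total Picard operator is chosen; its value at a discontinuous X is arbitrary, and the iterates
   below are all continuous. *)
have /choice[st stP] : forall X : R -> V, exists Y, continuous X -> step X Y.
  move=> X; have [cX|ncX] := pselect (continuous X).
    by have [Y XY] := step_exists cX; exists Y.
  by exists X.
pose X k := iter k st (fun=> x0).
have cX k : continuous (X k).
  elim: k => [|k IH]; first exact: cst_continuous.
  by have [] := stP _ IH.
have stX k : step (X k) (X k.+1) by exact: stP.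
pose B := `|g x0| / c.
have B0 : 0 <= B by rewrite divr_ge0// ltW.
(* The first increment has the constant derivative [g x0], which explains the value of [B]; each
   further one gains a factor 1/2 by contraction. *)
have X_diff k t : 0 <= t -> `|X k.+1 t - X k t| <= B / 2 ^+ k * expR (c * t).
  elim: k t => [|k IH] t t0.
    rewrite expr0 divr1; have [cX1 X10 dX1] := stX 0%N.
    apply: norm_le_coord; first by rewrite mulr_ge0// expR_ge0.
    move=> i j; rewrite ord1 !mxE.
    apply: (@norm_le_expR_of_derive _ (fun s => X 1%N s 0 j - x0 0 j)
      (fun s => g x0 0 j - 0)) => //.
    - move=> s; apply: cvgB; last exact: cvg_cst.
      apply: (@cvg_comp _ _ _ (X 1%N) (fun M : V => M 0 j)); first exact: cX1.
      exact: coord_continuous.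
    - by rewrite X10 subrr.
    - move=> s s0; have /is_derive_mxP/(_ 0 j) d1 := dX1 _ s0.
      exact: is_deriveB.
    - move=> s s0; rewrite subr0 (le_trans (coord_le_norm _ _ _))//.
      by rewrite ler_peMr// ltW// expR_gt1 mulr_gt0.
  rewrite exprSr invfM mulrA.
  apply: (step_contract _ (stX k.+1) (stX k)) => //.
  by rewrite divr_ge0 ?exprn_ge0.
have /choice[l lP] : forall t, exists l : V, 0 <= t ->
    forall k, `|l - X k t| <= B * 2 / 2 ^+ k * expR (c * t).
  move=> t; have [t0|_] := boolP (0 <= t); last by exists 0.
  have E0 : 0 <= B * expR (c * t) by rewrite mulr_ge0// expR_ge0.
  have /choice[l lP] : forall j : 'I_n, exists l, forall k,
      `|l - X k t 0 j| <= B * expR (c * t) * 2 / 2 ^+ k.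
    move=> j; apply: geometric_limit => // k.
    rewrite (_ : _ - _ = (X k.+1 t - X k t) 0 j); last by rewrite !mxE.
    rewrite (le_trans (coord_le_norm _ _ _))// (le_trans (X_diff _ _ t0))//.
    by rewrite mulrAC.
  exists (\row_j l j) => _ k; apply: norm_le_coord.
    apply: mulr_ge0; last exact: expR_ge0.
    by apply: divr_ge0; [exact: mulr_ge0|exact: exprn_ge0].
  move=> i j; rewrite !mxE ord1 (le_trans (lP _ _))//.
  by rewrite le_eqVlt; apply/orP; left; apply/eqP; ring.
have small (e : R) : 0 < e -> exists k : nat, B * 2 / 2 ^+ k <= e.
  move=> e0; have half_lt1 : `|2^-1 : R| < 1.
    by rewrite ger0_norm// invf_lt1// ltr1n.
  have /cvgrPdist_le/(_ _ e0)[k _ /(_ k (leqnn k))] :=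
    cvg_geometric (B * 2) half_lt1.
  rewrite /geometric/= sub0r normrN exprVn => ke.
  by exists k; rewrite (le_trans (ler_norm _)).
pose m0 (t : R) := Num.max t 0.
have m0_ge0 t : 0 <= m0 t by rewrite /m0 le_max lexx orbT.
have m0E t : 0 <= t -> m0 t = t by move=> t0; rewrite /m0 max_l.
have cm : continuous m0.
  by move=> t; apply: continuous_max; [exact: cvg_id|exact: cvg_cst].
(* The limit is controlled for nonnegative times only, so it is frozen at its value in 0 before
   that. *)
pose x t := l (m0 t).
have cx : continuous x.
  move=> t; apply/cvgrPdist_le => e e0.
  (* [E] dominates the weight up to one unit of time beyond t, so the iterates converge uniformly
     near t and the limit inherits their continuity. *)
  pose E := expR (c * (m0 t + 1)).
  have E0 : 0 < E by exact: expR_gt0.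
  have [k ke] := small (e / 3 / E) (ltac:(by rewrite !divr_gt0)).
  have bnd s : m0 s <= m0 t + 1 -> `|x s - X k (m0 s)| <= e / 3.
    move=> st1; rewrite (le_trans (lP _ (m0_ge0 s) k))//.
    rewrite -ler_pdivlMr ?expR_gt0// (le_trans ke)//.
    rewrite ler_wpM2l ?divr_ge0 ?(ltW e0)// lef_pV2 ?posrE ?expR_gt0//.
    by rewrite ler_expR ler_pM2l.
  have cXm : (X k \o m0) s @[s --> t] --> X k (m0 t).
    by apply: (@cvg_comp _ _ _ m0 (X k)); [exact: cm|exact: cX].
  have e30 : 0 < e / 3 by rewrite divr_gt0.
  have /cvgrPdist_le/(_ _ e30) near_Xm := cXm.
  near=> s.
  have -> : x t - x s = (x t - X k (m0 t)) + (X k (m0 t) - X k (m0 s)) + (X k (m0 s) - x s).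
    by rewrite !subrKA.
  have e3 : e = e / 3 + e / 3 + e / 3 by field.
  rewrite [leRHS]e3 (le_trans (ler_normD _ _))// lerD//; last first.
    rewrite distrC bnd//; near: s.
    have : m0 s @[s --> t] --> m0 t by exact: cm.
    move/cvgr_le; apply; rewrite ltrDl//.
  rewrite (le_trans (ler_normD _ _))// lerD//; first by rewrite bnd// lerDl.
  by near: s; exact: near_Xm.
(* The limit is a fixed point: its Picard image Y is within a contracted distance of the iterate
   [X k.+1], which is itself close to x, for every k. *)
have [Y [cY Y0 dY]] := step_exists cx.
have xX k t : 0 <= t -> `|x t - X k t| <= B * 2 / 2 ^+ k * expR (c * t).
  by move=> t0; rewrite /x m0E//; exact: lP.
have Yx t : 0 <= t -> Y t = x t.
  move=> t0; apply/eqP; rewrite -subr_eq0 -normr_le0; apply/ler_addgt0Pr => e e0.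
  rewrite add0r.
  have E0 : 0 < 2 * expR (c * t) by rewrite mulr_gt0// expR_gt0.
  have [k ke] := small (e / (2 * expR (c * t))) (ltac:(by rewrite divr_gt0)).
  have pk0 : 0 <= B * 2 / 2 ^+ k.
    by apply: divr_ge0; [exact: mulr_ge0|exact: exprn_ge0].
  have YX := step_contract pk0 (And3 cY Y0 dY) (stX k) (xX k) t0.
  rewrite -(subrKA (X k.+1 t)) (le_trans (ler_normD _ _))//.
  rewrite (@le_trans _ _ (B * 2 / 2 ^+ k / 2 * expR (c * t) +
                          B * 2 / 2 ^+ k.+1 * expR (c * t)))//.
    by rewrite lerD// distrC xX.
  rewrite (_ : B * 2 / 2 ^+ k.+1 = B * 2 / 2 ^+ k / 2); last first.
    by rewrite exprSr invfM mulrA.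
  rewrite (@le_trans _ _ (B * 2 / 2 ^+ k * (2 * expR (c * t))))//.
    rewrite -mulrDl -splitr ler_wpM2l// ler_peMl ?expR_ge0//.
    by rewrite ler1n.
  by rewrite -ler_pdivlMr.
exists x; split => //.
  by rewrite -Yx.
move=> t t0; apply: (@near_eq_is_derive _ _ _ Y); last exact: dY.
near=> s; rewrite Yx// ltW//; near: s; exact: lt_nbhsr.
Unshelve. all: by end_near. Qed.

End Picard.
(** * Lyapunov and Chetaev functions *)

Section Lyapunov.
Variables (R : realType) (V : normedModType R).
Implicit Types (f : V -> V) (Y : V -> R) (x : R -> V) (p : V).

Lemma is_derive_orbital Y x (t : R) v : differentiable Y (x t) ->
  is_derive t 1 x v -> is_derive t 1 (Y \o x) ('D_v Y (x t)).
Proof.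
move=> dY [dx xv].
have dx' : differentiable x t by exact/derivable1_diffP.
have dYx : differentiable (Y \o x) t by exact: differentiable_comp.
apply: DeriveDef; first exact/derivable1_diffP.
by rewrite deriveE// diff_comp//= -xv !deriveE.
Qed.

Lemma continuous_ball (h : V -> R) p (e : R) : {for p, continuous h} ->
  0 < e -> exists2 r : R, 0 < r & forall z, `|z - p| < r -> `|h z - h p| < e.
Proof.
move=> /cvgrPdist_lt hp e0; have /nbhs_ballP[r r0 rh] := hp _ e0.
exists r => // z zr; rewrite distrC; apply: rh.
by rewrite -ball_normE/= distrC.
Qed.

Lemma continuous_forward x : {within `[0, +oo[, continuous x} ->
  continuous (fun t : R => x (Num.max t 0)).
Proof.
move=> /subspace_continuousP cx t.
have max_ge0 (s : R) : [set` `[0, +oo[] (Num.max s 0).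
  by rewrite /= in_itv/= andbT le_max lexx orbT.
have cm : continuous (fun t : R => Num.max t 0).
  by move=> s; apply: continuous_max; [exact: cvg_id|exact: cvg_cst].
apply: cvg_comp; last exact: (cx _ (max_ge0 t)).
move=> P /= /(cm t); apply: (@filterS _ (nbhs t)) => s.
by apply; exact: max_ge0.
Qed.

(** Freezing negative times at the initial value turns one-sided continuity at 0 into continuity on
    the line, without changing the solution at nonnegative times. *)
Lemma forward_solution_continuous f x : forward_solution f x ->
  exists2 y : R -> V, continuous y &
    (forall t : R, 0 <= t -> y t = x t) /\
    forall t : R, 0 < t -> is_derive t 1 y (f (y t)).
Proof.
move=> [cx dx]; exists (fun t : R => x (Num.max t 0)).
  exact: continuous_forward.
have yx (t : R) : 0 <= t -> x (Num.max t 0) = x t by move=> t0; rewrite max_l.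
split=> // t t0; rewrite yx ?ltW//.
have xy : \near t, x t = x (Num.max t 0).
  by near=> s; rewrite yx// ltW//; near: s; exact: lt_nbhsr.
exact: (near_eq_is_derive xy) (dx _ t0).
Unshelve. all: by end_near. Qed.

Lemma le_of_derive_le0 (u u' : R -> R) (T : R) : 0 <= T -> continuous u ->
  (forall t : R, 0 < t < T -> is_derive t 1 u (u' t)) ->
  (forall t : R, 0 < t < T -> u' t <= 0) -> u T <= u 0.
Proof.
move=> T0 cu du u'0.
apply: (@ler0_derive1_le_cc _ u 0 T) => //; rewrite ?in_itv/= ?lexx ?T0//.
- by move=> t; rewrite in_itv/= => /du[].
- move=> t; rewrite in_itv/= => tT; have [_ dut] := du _ tT.
  by rewrite derive1E dut u'0.
- exact: continuous_subspaceT.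
Qed.

(** The times in [0, t] at which h equals e form a compact set, nonempty by the intermediate value
    theorem; s is its minimum. A value at least e before s would produce a still earlier hit. *)
Lemma first_hitting_time (h : R -> R) (e t : R) : continuous h -> 0 <= t ->
  h 0 < e -> e <= h t ->
  exists2 s, 0 <= s & h s = e /\ forall u, 0 <= u < s -> h u < e.
Proof.
move=> ch t0 h0 ht.
have hit u : 0 <= u -> e <= h u -> exists2 c, 0 <= c <= u & h c = e.
  move=> u0 hu; have [] := @IVT _ h 0 u e u0.
  - exact: continuous_subspaceT.
  - by rewrite ge_min le_max (ltW h0) hu orbT.
  - by move=> c; rewrite in_itv/= => cu hc; exists c.
pose A := `[0, t] `&` h @^-1` [set e].
have cA : compact A.
  apply: compact_closedI; first exact: segment_compact.
  by apply: preimage_closed; [move=> ? _; exact: ch|exact: closed_eq].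
have A0 : A !=set0 by have [c ct hc] := hit t t0 ht; exists c; split.
have cid : {within A, continuous (@idfun R)}.
  by apply: continuous_subspaceT => ?; exact: cvg_id.
have [s + smin] := compact_EVT_min A0 cA cid.
rewrite inE => -[+ hs]; rewrite /= in_itv/= => /andP[s0 st].
exists s => //; split => // u /andP[u0 us]; rewrite ltNge; apply/negP => hu.
have [c /andP[c0 cu] hc] := hit u u0 hu.
suff : c \in A by move=> /smin/= sc; have := lt_le_trans us sc; rewrite ltNge cu.
by rewrite inE; split=> //=; rewrite in_itv/= c0 (le_trans cu)// (le_trans (ltW us)).
Qed.

Section LyapunovFunction.
Variables (Y : V -> R) (p : V).
Hypothesis dY : forall z, differentiable Y z.

Let cY : continuous Y.
Proof. by move=> z; exact/differentiable_continuous. Qed.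

Let cYx x : continuous x -> continuous (Y \o x).
Proof. by move=> cx t; apply: (@cvg_comp _ _ _ x Y); [exact: cx|exact: cY]. Qed.

Let cnorm x : continuous x -> continuous (fun t => `|x t - p|).
Proof.
by move=> cx t; apply: cvg_norm; apply: cvgB; [exact: cx|exact: cvg_cst].
Qed.

(** At a first time s with |x(s) - p| = e, monotonicity of Y would give e^2 <= C Y(x(s)) <= C
    Y(x(0)) < e^2. The equation is required only inside the ball of radius r, so the lemma also
    applies to solutions of a field that agrees with f there. *)
Lemma lyapunov_trap f (r C e : R) x :
  (forall z, `|z - p| < r ->
    `|z - p| ^+ 2 <= C * Y z /\ 'D_(f z) Y z <= 0) ->
  0 <= C -> 0 < e < r -> continuous x ->
  (forall t : R, 0 < t -> `|x t - p| < r -> is_derive t 1 x (f (x t))) ->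
  `|x 0 - p| < e -> C * Y (x 0) < e ^+ 2 ->
  forall t, 0 <= t -> `|x t - p| < e.
Proof.
move=> Yr C0 /andP[e0 er] cx dx x0e Y0e t t0; rewrite ltNge; apply/negP => ext.
have [s s0 [xse xe]] := first_hitting_time (cnorm cx) t0 x0e ext.
have xr u : 0 < u < s -> `|x u - p| < r.
  by move=> /andP[u0 us]; rewrite (lt_trans _ er)// xe// ltW.
have Ys : (Y \o x) s <= (Y \o x) 0.
  apply: (@le_of_derive_le0 _ (fun u => 'D_(f (x u)) Y (x u))) => //.
  - exact: cYx.
  - move=> u us; apply: is_derive_orbital => //.
    by apply: dx; [case/andP: us|exact: xr].
  - by move=> u us; have [] := Yr _ (xr _ us).
have [|+ _] := Yr (x s); first by rewrite xse.
rewrite xse leNgt => /negP; apply; apply: le_lt_trans Y0e.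
by rewrite ler_wpM2l.
Qed.

(** The globally solvable field g supplies existence: its solutions are trapped where g = f, hence
    solve the original equation. Attraction holds because Y exp(k t) is nonincreasing along trapped
    solutions and C Y dominates the squared distance. *)
Lemma lyapunov_asymptotically_stable f g (C k r : R) :
  0 <= C -> 0 < k -> 0 < r -> Y p = 0 ->
  (forall z, `|z - p| < r -> [/\ `|z - p| ^+ 2 <= C * Y z,
     'D_(f z) Y z <= - k * Y z & g z = f z]) ->
  (forall z0, exists x : R -> V, [/\ continuous x, x 0 = z0 &
     forall t : R, 0 < t -> is_derive t 1 x (g (x t))]) ->
  asymptotically_stable f p.
Proof.
move=> C0 k0 r0 Yp Yr g_sol.
have Yge0 z : `|z - p| < r -> 0 <= C * Y z.
  by move=> /Yr[+ _ _]; apply: le_trans; rewrite exprn_ge0.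
(* Needed to pass from C Y >= 0 to Y >= 0; at p itself, Y vanishes by hypothesis. *)
have C_gt0 z : `|z - p| < r -> z != p -> 0 < C.
  move=> /Yr[+ _ _] zp; rewrite lt_neqAle C0 andbT; apply: contraTneq => <-.
  by rewrite mul0r -ltNge exprn_gt0// normr_gt0 subr_eq0.
have Yr0 z : `|z - p| < r ->
    `|z - p| ^+ 2 <= C * Y z /\ 'D_(f z) Y z <= 0.
  move=> zr; have [YC DY _] := Yr _ zr; split => //.
  rewrite (le_trans DY)// mulNr oppr_le0 mulr_ge0// ?(ltW k0)//.
  have [->|zp] := eqVneq z p; first by rewrite Yp.
  by rewrite -(pmulr_rge0 _ (C_gt0 _ zr zp)) Yge0.
have trap (e : R) : 0 < e < r -> exists2 d : R, 0 < d & forall x, continuous x ->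
    (forall t : R, 0 < t -> `|x t - p| < r -> is_derive t 1 x (f (x t))) ->
    `|x 0 - p| < d -> forall t, 0 <= t -> `|x t - p| < e.
  move=> /andP[e0 er].
  (* Dividing by C + 1 instead of C covers the case C = 0. *)
  have e2C : 0 < e ^+ 2 / (C + 1) by rewrite divr_gt0 ?exprn_gt0// ltr_wpDl.
  have [d d0 dY'] := continuous_ball (cY (x := p)) e2C.
  exists (Num.min d e); first by rewrite lt_min d0 e0.
  move=> x cx dx; rewrite lt_min => /andP[xd xe].
  apply: (lyapunov_trap Yr0) => //; first by rewrite e0 er.
  have := dY' _ xd; rewrite Yp subr0 ltr_pdivlMr ?ltr_wpDl// => Ye.
  rewrite (le_lt_trans _ Ye)// (le_trans (ler_norm _))// normrM (ger0_norm C0).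
  by rewrite mulrC ler_wpM2l// lerDl.
have stable : lyapunov_stable f p.
  move=> e e0; pose e' := Num.min e (r / 2).
  have e'r : 0 < e' < r.
    by rewrite lt_min e0 divr_gt0//= gt_min; apply/orP; right; lra.
  have [d d0 dtrap] := trap _ e'r; exists d => // z0 z0d; split; last first.
    move=> x /forward_solution_continuous[y cy [yx dy]] x0 t t0.
    rewrite -yx// (@lt_le_trans _ _ e')//; last by rewrite ge_min lexx.
    by apply: dtrap => //; [move=> ? /dy|rewrite yx// x0].
  have [x [cx x0 dx]] := g_sol z0.
  have xe : forall t, 0 <= t -> `|x t - p| < e'.
    apply: dtrap => //; last by rewrite x0.
    by move=> t t0 /Yr[_ _ <-]; exact: dx.
  exists x => //; split; first exact: continuous_subspaceT.
  move=> t t0; have [|_ _ <-] := Yr (x t); last exact: dx.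
  by case/andP: e'r => _; apply: lt_trans; rewrite xe// ltW.
split => //.
have r2 : 0 < r / 2 < r by apply/andP; split; lra.
have [d d0 dtrap] := trap _ r2; exists d => //.
move=> x /forward_solution_continuous[y cy [yx dy]] xd.
have yr t : 0 <= t -> `|y t - p| < r.
  move=> t0; case/andP: r2 => _; apply: lt_trans.
  by apply: dtrap => //; [move=> ? /dy|rewrite yx].
have decay t : 0 <= t -> Y (y t) * expR (k * t) <= Y (y 0).
  move=> t0; pose w s := Y (y s) * expR (k * s).
  have -> : Y (y 0) = w 0 by rewrite /w mulr0 expR0 mulr1.
  pose w' s := Y (y s) * (expR (k * s) * k) + expR (k * s) * 'D_(f (y s)) Y (y s).
  apply: (@le_of_derive_le0 w w') => //.
  - move=> s; apply: cvgM; first exact: (cYx cy).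
    apply: (@cvg_comp _ _ _ (fun r => k * r) expR); last exact: continuous_expR.
    by apply: cvgM; [exact: cvg_cst|exact: cvg_id].
  - move=> s /andP[s0 _]; apply: (@is_deriveM _ _ (Y \o y) (fun s => expR (k * s))).
      exact/is_derive_orbital/dy.
    have dks : is_derive s 1 (fun s : R => k * s) k.
      by apply: is_derive_eq; rewrite scaler1.
    exact: (@is_derive1_comp _ expR _ _ _ _ (is_derive_expR _) dks).
  - move=> s /andP[s0 _]; have [_ DY _] := Yr _ (yr _ (ltW s0)).
    rewrite /w' mulrCA -mulrDr pmulr_rle0 ?expR_gt0//; lra.
apply/cvgrPdist_le => e e0; rewrite /=.
pose M := C * Y (y 0); have M0 : 0 <= M by exact/Yge0/yr.
(* Beyond this time M <= e^2 k t <= e^2 exp(k t), by exp(u) >= 1 + u. *)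
exists (M / (e ^+ 2 * k)); split; first exact: num_real.
move=> t; rewrite ltr_pdivrMr ?mulr_gt0 ?exprn_gt0// => Mt.
have t0 : 0 <= t.
  rewrite -(pmulr_lge0 _ (_ : 0 < e ^+ 2 * k)) ?mulr_gt0 ?exprn_gt0//.
  exact: le_trans M0 (ltW Mt).
rewrite distrC -yx// -ler_sqr ?nnegrE ?(ltW e0)//.
have [YC _ _] := Yr _ (yr _ t0); apply: le_trans YC _.
rewrite -(ler_pM2r (expR_gt0 (k * t))) -mulrA (@le_trans _ _ M)//.
  by rewrite ler_wpM2l// decay.
rewrite (le_trans (ltW Mt))// mulrCA ler_wpM2l ?exprn_ge0 ?ltW//.
rewrite mulrC (lt_le_trans _ (expR_ge1Dx _))// ltrDr//.
Qed.

(** A trapped solution starting with Y > 0 keeps Y at least at its initial value, so Y grows at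
    least linearly with slope k Y(x(0))^2, against its boundedness near p. The growth condition is
    quadratic in Y because at a center direction nothing stronger is available. *)
Lemma chetaev_unstable f (k r : R) : 0 < k -> 0 < r ->
  (forall z, `|z - p| < r -> 0 <= 'D_(f z) Y z /\
     (0 < Y z -> k * Y z ^+ 2 <= 'D_(f z) Y z)) ->
  (forall e : R, 0 < e -> exists2 z, `|z - p| < e & 0 < Y z) ->
  unstable f p.
Proof.
move=> k0 r0 Yr Ypos stable.
have [r1 r10 Y1] := continuous_ball (cY (x := p)) ltr01.
have [] := stable (Num.min r r1); first by rewrite lt_min r0.
move=> d d0 dstable; have [z0 z0d Yz0] := Ypos _ d0.
have [[x xsol x0] /(_ x xsol x0)] := dstable _ z0d.
have [y cy [yx dy]] := forward_solution_continuous xsol.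
move=> xr; have {}xr t : 0 <= t -> `|y t - p| < r /\ `|y t - p| < r1.
  by move=> t0; rewrite yx//; apply/andP; rewrite -lt_min xr.
rewrite -x0 -yx// in Yz0.
have Ymono t : 0 <= t -> Y (y 0) <= Y (y t).
  move=> t0; rewrite -lerN2.
  apply: (@le_of_derive_le0 (fun s => - Y (y s))
    (fun s => - 'D_(f (y s)) Y (y s))) => //.
  - by move=> s; apply: cvgN; exact: (cYx cy).
  - move=> s /andP[s0 _]; apply: is_deriveN; exact/is_derive_orbital/dy.
  - move=> s /andP[s0 _]; rewrite oppr_le0.
    by have [/Yr[]] := xr _ (ltW s0).
pose m := k * Y (y 0) ^+ 2.
have m0 : 0 < m by rewrite mulr_gt0// exprn_gt0.
have Ygrow t : 0 <= t -> Y (y 0) + m * t <= Y (y t).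
  move=> t0; rewrite -lerBrDr -lerN2 opprB.
  have -> : - Y (y 0) = m * 0 - Y (y 0) by rewrite mulr0 sub0r.
  apply: (@le_of_derive_le0 (fun s => m * s - Y (y s))
    (fun s => m - 'D_(f (y s)) Y (y s))); first exact: t0.
  - move=> s; apply: cvgB; last exact: (cYx cy).
    by apply: cvgM; [exact: cvg_cst|exact: cvg_id].
  - move=> s /andP[s0 _]; apply: is_deriveB; last exact/is_derive_orbital/dy.
    by apply: is_derive_eq; rewrite scaler1.
  - move=> s /andP[s0 _]; rewrite subr_le0.
    have Ys := Ymono _ (ltW s0).
    have [/Yr[_ +] _] := xr _ (ltW s0); move=> /(_ (lt_le_trans Yz0 Ys)).
    apply: le_trans; rewrite ler_wpM2l ?(ltW k0)//.
    by rewrite ler_sqr ?nnegrE// ?ltW// (lt_le_trans Yz0).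
(* By time T the linear growth exceeds Y p + 1, the bound valid in the ball of radius [r1]. *)
pose T := (`|Y p| + 1) / m.
have T0 : 0 <= T by rewrite divr_ge0 ?addr_ge0// ltW.
have := Ygrow _ T0; rewrite /T mulrC divfK ?gt_eqF//; apply/negP; rewrite -ltNge.
have [_ /Y1] := xr _ T0; have := ler_norm (Y p); have := ler_norm (Y (y T) - Y p).
rewrite -/T; lra.
Qed.

End LyapunovFunction.

End Lyapunov.
(** * Jacobians and characteristic polynomials *)

Lemma char_poly3 (K : comNzRingType) (A : 'M[K]_3) :
  char_poly A = 'X^3 - (A 0 0 + A 1 1 + A 2 2)%:P * 'X^2
    + (A 0 0 * A 1 1 - A 0 1 * A 1 0 + A 0 0 * A 2 2 - A 0 2 * A 2 0
       + A 1 1 * A 2 2 - A 1 2 * A 2 1)%:P * 'X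
    - (A 0 0 * (A 1 1 * A 2 2 - A 1 2 * A 2 1)
       - A 0 1 * (A 1 0 * A 2 2 - A 1 2 * A 2 0)
       + A 0 2 * (A 1 0 * A 2 1 - A 1 1 * A 2 0))%:P.
Proof.
(* The next equations name the indices that survive when a row or column is deleted in the cofactor
   expansion. *)
have e1 : lift (0 : 'I_3) (0 : 'I_2) = 1 by apply: val_inj.
have e2 : lift (0 : 'I_3) (1 : 'I_2) = 2 by apply: val_inj.
have e3 : lift (1 : 'I_3) (0 : 'I_2) = 0 by apply: val_inj.
have e4 : lift (1 : 'I_3) (1 : 'I_2) = 2 by apply: val_inj.
have e5 : lift (2 : 'I_3) (0 : 'I_2) = 0 by apply: val_inj.
have e6 : lift (2 : 'I_3) (1 : 'I_2) = 1 by apply: val_inj.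
have e7 : lift (1 : 'I_2) (0 : 'I_1) = 0 by apply: val_inj.
have l1 : lift ord0 (lift ord0 ord0) = 2 :> 'I_3 by apply: val_inj.
have l0 : lift ord0 ord0 = 1 :> 'I_3 by apply: val_inj.
have l0' : lift ord0 ord0 = 1 :> 'I_2 by apply: val_inj.
rewrite /char_poly (expand_det_row _ 0) !big_ord_recl big_ord0 l0 l1.
rewrite -[ord0]/(0 : 'I_3).
rewrite /cofactor !(expand_det_row _ 0) !big_ord_recl !big_ord0 /cofactor.
rewrite !det_mx11 !mxE l0' -[ord0]/(0 : 'I_2) e7 e1 e2 e3 e4 e5 e6 /=.
rewrite !(modn_small, polyCD, polyCN, polyCM)//= ?mulr1n ?mulr0n.
by ring.
Qed.

Lemma differentiable_rVP (R : numFieldType) (V : normedModType R) n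
    (f : V -> 'rV[R]_n) (x : V) :
  (forall j, differentiable (fun z => f z 0 j) x) -> differentiable f x.
Proof.
move=> df; rewrite (_ : f = \sum_(j < n) (fun z => f z 0 j *: 'e_j)).
  by apply: differentiable_sum => j; exact: differentiableZl.
apply/funext => z; rewrite fct_sumE; exact: row_sum_delta.
Qed.

Lemma jacobianE (R : realFieldType) m n (f : 'rV[R]_m -> 'rV[R]_n)
    (p : 'rV[R]_m) i j d : differentiable f p ->
  is_derive p ('e_i : 'rV[R]_m) (fun x => f x 0 j) d -> jacobian f p i j = d.
Proof.
move=> df [_ <-]; have := deriveEjacobian 'e_i df; rewrite -rowE.
move=> /rowP/(_ j); rewrite [RHS]mxE => <-.
by rewrite derive_mx ?mxE//; exact: diff_derivable.
Qed.
(** * Quadratic estimates *)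

Section QuadraticEstimates.
Variable R : realType.
Implicit Types al ka w th tau d e y G z : R.

Let sq_bound (c B t : R) : `|c| <= B -> - (B * t ^+ 2) <= c * t ^+ 2.
Proof.
by rewrite ler_norml => /andP[Bc _]; rewrite -mulNr ler_wpM2r// sqr_ge0.
Qed.

Let prod_bound (c B s t : R) : `|c| <= B ->
  - (B * (s ^+ 2 + t ^+ 2) / 2) <= c * (s * t).
Proof.
move=> cB; rewrite lerNl; apply: (le_trans (ler_norm _)).
rewrite normrN normrM -mulrA; apply: ler_pM => //.
rewrite normrM ler_pdivlMr// -(real_normK (num_real s)) -(real_normK (num_real t)).
by rewrite -subr_ge0 (_ : _ - _ = (`|s| - `|t|) ^+ 2) ?sqr_ge0//; ring.
Qed.

Let scale_bound (c a B : R) : 0 <= c <= 1 -> `|a| <= B -> `|c * a| <= B.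
Proof.
move=> /andP[c0 c1] aB; rewrite normrM (ger0_norm c0).
by rewrite (le_trans _ aB)// ler_piMl.
Qed.

(** The right side is the derivative of tau z^2 - (d tau / 2) G^2 + 4 d G z along G' = ka G + 2 z,
    z' = al z + w G. For al = 0, ka = - tau, w = d the first two coefficients make their G z
    contributions cancel, and the cross term 4 d G z supplies the positive z^2. This main part is at
    least d / 16 times G^2 + z^2; the deviations cost at most 10 e = d / 32. *)
Lemma saddle_estimate tau d al ka w e G z :
  1 / 2 <= tau <= 1 -> 0 < d <= 1 -> e = d / 320 ->
  `|al| <= e -> `|ka + tau| <= e -> `|w - d| <= e ->
  d / 32 * (G ^+ 2 + z ^+ 2) <=
  tau * (2 * z * (al * z + w * G)) - d * tau / 2 * (2 * G * (ka * G + 2 * z))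
  + 4 * d * ((ka * G + 2 * z) * z + G * (al * z + w * G)).
Proof.
move=> /andP[tau0 tau1] /andP[d0 d1] eE al_e ka_e w_e.
pose s := z - tau * G / 4.
have tau01 : 0 <= tau <= 1 by apply/andP; split; lra.
have d01 : 0 <= d <= 1 by apply/andP; split; lra.
have kan : `|- (ka + tau)| <= e by rewrite normrN.
rewrite [leRHS](_ : _ = d * (8 * s ^+ 2 + (tau ^+ 2 / 2 + 4 * d) * G ^+ 2)
  + (2 * ((tau * al) * z ^+ 2) + 2 * ((tau * (w - d)) * (z * G))
     + (d * (tau * - (ka + tau))) * G ^+ 2 + 4 * ((d * (ka + tau)) * (G * z))
     + 4 * ((d * al) * (G * z)) + 4 * ((d * (w - d)) * G ^+ 2))); last first.
  by rewrite /s; field.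
have b1 := sq_bound z (scale_bound tau01 al_e).
have b2 := prod_bound z G (scale_bound tau01 w_e).
have b3 := sq_bound G (scale_bound d01 (scale_bound tau01 kan)).
have b4 := prod_bound G z (scale_bound d01 ka_e).
have b5 := prod_bound G z (scale_bound d01 al_e).
have b6 := sq_bound G (scale_bound d01 w_e).
have base : 1 / 16 * (G ^+ 2 + z ^+ 2) <=
    8 * s ^+ 2 + (tau ^+ 2 / 2 + 4 * d) * G ^+ 2.
  have zE : z = s + tau * G / 4 by rewrite /s; lra.
  have t2 : 1 / 4 <= tau ^+ 2 by nra.
  have t3 : tau ^+ 2 <= 1 by nra.
  have G2 := sqr_ge0 G; have s2 := sqr_ge0 s.
  have q : 0 <= (s - tau * G / 4) ^+ 2 by exact: sqr_ge0.
  have tG : tau ^+ 2 * G ^+ 2 <= G ^+ 2 by rewrite ler_piMl.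
  have tG' : 1 / 4 * G ^+ 2 <= tau ^+ 2 * G ^+ 2 by rewrite ler_wpM2r.
  have dG : 0 <= d * G ^+ 2 by rewrite mulr_ge0// ltW.
  rewrite zE; nra.
have dbase : d * (1 / 16 * (G ^+ 2 + z ^+ 2)) <=
    d * (8 * s ^+ 2 + (tau ^+ 2 / 2 + 4 * d) * G ^+ 2).
  by rewrite ler_wpM2l// ltW.
have dG := mulr_ge0 (ltW d0) (sqr_ge0 G).
have dz := mulr_ge0 (ltW d0) (sqr_ge0 z).
move: b1 b2 b3 b4 b5 b6 dbase; rewrite eE; lra.
Qed.

(** Combined with [saddle_estimate], this bounds the derivative of the Chetaev function below by d /
    96 times the function. *)
Lemma saddle_upper tau d G z : 1 / 2 <= tau <= 1 -> 0 < d <= 1 ->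
  tau * z ^+ 2 - d * tau / 2 * G ^+ 2 + 4 * d * (G * z) <=
  3 * (G ^+ 2 + z ^+ 2).
Proof.
move=> /andP[tau0 tau1] /andP[d0 d1].
have z2 := sqr_ge0 z; have G2 := sqr_ge0 G.
have tz : tau * z ^+ 2 <= z ^+ 2 by rewrite ler_piMl.
have tG : 0 <= d * tau / 2 * G ^+ 2.
  by rewrite mulr_ge0// divr_ge0// mulr_ge0 ?ltW//; lra.
have dGz : - (1 * (G ^+ 2 + z ^+ 2) / 2) <= - d * (G * z).
  by apply: prod_bound; rewrite normrN ger0_norm// ltW.
lra.
Qed.

(** Only G is damped directly, so the weights of z^2 and G^2 are matched to cancel their exchange,
    and the small cross term - (d / 2) G z makes the derivative negative in z too. The bound d <=
    tau^2 keeps the coefficient of G^2 positive after completing the square; the deviations use at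
    most half of the resulting d / 20. *)
Lemma sink_estimate tau d al ka w e y G z :
  1 / 2 <= tau <= 2 / 3 -> 0 < d <= tau ^+ 2 -> e = d / 160 ->
  `|al| <= e -> `|ka + tau| <= e -> `|w + d| <= e ->
  2 * y * (ka * y) + tau * (2 * z * (al * z + w * G))
  + d * tau / 2 * (2 * G * (ka * G + 2 * z))
  - d / 2 * ((ka * G + 2 * z) * z + G * (al * z + w * G))
  <= - (d / 40) * (y ^+ 2 + G ^+ 2 + z ^+ 2).
Proof.
move=> /andP[tau0 tau1] /andP[d0 dt] eE al_e ka_e w_e.
have t3 : tau ^+ 2 <= 4 / 9 by nra.
have t2 : 1 / 4 <= tau ^+ 2 by nra.
pose s := z - tau * G / 4.
have tau01 : 0 <= tau <= 1 by apply/andP; split; lra.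
have d01 : 0 <= d <= 1.
  by rewrite ltW//=; apply: (le_trans dt); apply: (le_trans t3); lra.
have kan : `|- (ka + tau)| <= e by rewrite normrN.
have wn : `|- (w + d)| <= e by rewrite normrN.
have aln : `|- al| <= e by rewrite normrN.
have ky : ka * y ^+ 2 <= - (1 / 4) * y ^+ 2.
  rewrite ler_wpM2r ?sqr_ge0//; move: ka_e; rewrite ler_norml => /andP[_]; lra.
have b1 := sq_bound z (scale_bound tau01 aln).
have b2 := prod_bound z G (scale_bound tau01 wn).
have b3 := sq_bound G (scale_bound d01 (scale_bound tau01 kan)).
have b4 := prod_bound G z (scale_bound d01 ka_e).
have b5 := prod_bound G z (scale_bound d01 al_e).
have b6 := sq_bound G (scale_bound d01 w_e).
rewrite -lerN2.
rewrite [leRHS](_ : _ = - 2 * (ka * y ^+ 2)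
  + d * (s ^+ 2 + (15 / 16 * tau ^+ 2 - d / 2) * G ^+ 2)
  + (2 * ((tau * - al) * z ^+ 2) + 2 * ((tau * - (w + d)) * (z * G))
     + (d * (tau * - (ka + tau))) * G ^+ 2 + 1 / 2 * ((d * (ka + tau)) * (G * z))
     + 1 / 2 * ((d * al) * (G * z)) + 1 / 2 * ((d * (w + d)) * G ^+ 2))); last first.
  by rewrite /s; field.
have base : 1 / 20 * (G ^+ 2 + z ^+ 2) <=
    s ^+ 2 + (15 / 16 * tau ^+ 2 - d / 2) * G ^+ 2.
  have zE : z = s + tau * G / 4 by rewrite /s; lra.
  have G2 := sqr_ge0 G; have s2 := sqr_ge0 s.
  have q : 0 <= (s - tau * G / 4) ^+ 2 by exact: sqr_ge0.
  have tG : tau ^+ 2 * G ^+ 2 <= G ^+ 2 by rewrite ler_piMl//; lra.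
  have tG' : 1 / 4 * G ^+ 2 <= tau ^+ 2 * G ^+ 2 by rewrite ler_wpM2r.
  have dG : d * G ^+ 2 <= tau ^+ 2 * G ^+ 2 by rewrite ler_wpM2r.
  rewrite zE; nra.
have dbase : d * (1 / 20 * (G ^+ 2 + z ^+ 2)) <=
    d * (s ^+ 2 + (15 / 16 * tau ^+ 2 - d / 2) * G ^+ 2).
  by rewrite ler_wpM2l// ltW.
have dG := mulr_ge0 (ltW d0) (sqr_ge0 G).
have dz := mulr_ge0 (ltW d0) (sqr_ge0 z).
have dy : d * y ^+ 2 <= y ^+ 2.
  by rewrite ler_piMl ?sqr_ge0//; case/andP: d01.
have y2 := sqr_ge0 y.
move: b1 b2 b3 b4 b5 b6 dbase; rewrite eE; lra.
Qed.

(** The lower bound lets the Lyapunov function control the coordinates; the upper one turns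
    [sink_estimate] into exponential decay. *)
Lemma sink_bounds tau d y G z : 1 / 2 <= tau <= 2 / 3 -> 0 < d <= tau ^+ 2 ->
  d / 8 * (y ^+ 2 + G ^+ 2 + z ^+ 2) <=
    y ^+ 2 + tau * z ^+ 2 + d * tau / 2 * G ^+ 2 - d / 2 * (G * z) <=
  2 * (y ^+ 2 + G ^+ 2 + z ^+ 2).
Proof.
move=> /andP[tau0 tau1] /andP[d0 dt].
have t3 : tau ^+ 2 <= 4 / 9 by nra.
have d1 : d <= 4 / 9 by lra.
have z2 := sqr_ge0 z; have G2 := sqr_ge0 G; have y2 := sqr_ge0 y.
have dy : d * y ^+ 2 <= y ^+ 2 by rewrite ler_piMl//; lra.
have dG := mulr_ge0 (ltW d0) G2.
have tz : 1 / 2 * z ^+ 2 <= tau * z ^+ 2 by rewrite ler_wpM2r.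
have tz' : tau * z ^+ 2 <= 1 * z ^+ 2 by rewrite ler_wpM2r//; lra.
have dz : d * z ^+ 2 <= 4 / 9 * z ^+ 2 by rewrite ler_wpM2r.
have dG' : d * G ^+ 2 <= 4 / 9 * G ^+ 2 by rewrite ler_wpM2r.
have tG : 1 / 2 * (d * G ^+ 2) <= tau * (d * G ^+ 2) by rewrite ler_wpM2r.
have tG' : tau * (d * G ^+ 2) <= 1 * (d * G ^+ 2) by rewrite ler_wpM2r//; lra.
have q : 0 <= d * (G / 2 - z) ^+ 2 by rewrite mulr_ge0 ?sqr_ge0// ltW.
have q' : 0 <= d * (G + z) ^+ 2 by rewrite mulr_ge0 ?sqr_ge0// ltW.
by apply/andP; split; nra.
Qed.

(** The right side is the derivative of - z - 2 (y^2 + (G - 3 z)^2) when w = 0. With g = G - 3 z,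
    the term - al z contributes 3 z^2 and the damping of y and g contributes 8/3 (y^2 + g^2); cross
    terms and the remainder [th] are absorbed. *)
Lemma center_estimate l al ka th e y G z :
  0 <= l <= 3 / 2 -> e = 1 / 100 ->
  al = 2 * z - 5 / 3 * G - l / 9 * y + th ->
  `|al| <= e -> `|ka + 2 / 3| <= e -> `|th| <= e * (`|y| + `|G|) ->
  y ^+ 2 + (G - 3 * z) ^+ 2 + z ^+ 2 <=
  - 2 * (2 * y * (ka * y)) - 18 * (2 * z * (al * z))
  - 2 * (2 * G * (ka * G + 2 * z))
  + 12 * ((ka * G + 2 * z) * z + G * (al * z)) - al * z.
Proof.
move=> /andP[l0 l1] eE alE al_e ka_e th_e.
pose g := G - 3 * z; have GE : G = g + 3 * z by rewrite /g; lra.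
have e0 : 0 <= e by rewrite eE.
have thz : `|th * z| <= e * (4 * (y ^+ 2 + g ^+ 2 + z ^+ 2)).
  rewrite normrM (le_trans (ler_wpM2r (normr_ge0 _) th_e))// -mulrA ler_wpM2l//.
  have Gg : `|G| <= `|g| + 3 * `|z|.
    by rewrite GE (le_trans (ler_normD _ _))// normrM (@ger0_norm _ 3).
  rewrite -(real_normK (num_real y)) -(real_normK (num_real g)).
  rewrite -(real_normK (num_real z)).
  have := normr_ge0 y; have := normr_ge0 g; have := normr_ge0 z.
  move: (`|y|) (`|G|) (`|g|) (`|z|) Gg => y' G' g' z' Gg z0 g0 y0.
  have : (y' + G') * z' <= (y' + (g' + 3 * z')) * z' by rewrite ler_wpM2r// lerD2l.
  have := sqr_ge0 (y' - z'); have := sqr_ge0 (g' - z'); nra.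
have thz' : th * z <= e * (4 * (y ^+ 2 + g ^+ 2 + z ^+ 2)).
  exact: le_trans (ler_norm _) thz.
have b1 := sq_bound y ka_e; have b2 := sq_bound g ka_e.
have kan : `|- (ka + 2 / 3)| <= e by rewrite normrN.
have b1' := sq_bound y kan; have b2' := sq_bound g kan.
have b3 := prod_bound g z kan.
have b4 := prod_bound g z al_e.
have l9 : `|l / 9| <= 1 / 6 by rewrite ger0_norm; lra.
have b5 := prod_bound y z l9.
(* This square absorbs the cross term 5/3 g z, spending z^2 out of 3 z^2 and 25/36 g^2 out of 8/3
   g^2. *)
have q := sqr_ge0 (5 / 6 * g + z).
have [y2 g2 z2] : [/\ 0 <= y ^+ 2, 0 <= g ^+ 2 & 0 <= z ^+ 2].
  by split; exact: sqr_ge0.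
rewrite [leRHS](_ : _ = 3 * z ^+ 2 + 5 / 3 * (g * z) + l / 9 * (y * z) - th * z
  - 4 * ((ka + 2 / 3) * y ^+ 2) - 4 * ((ka + 2 / 3) * g ^+ 2)
  + 8 / 3 * (y ^+ 2 + g ^+ 2)
  + 12 * (- (ka + 2 / 3) * (g * z)) + 12 * (al * (g * z))
  + (2 * z - 5 / 3 * G - l / 9 * y + th - al) * z); last by rewrite GE; field.
rewrite -alE subrr mul0r addr0.
rewrite -/g.
move: thz' b1 b2 b1' b2' b3 b4 b5 q; rewrite eE; lra.
Qed.

End QuadraticEstimates.

(** * Bounded Lipschitz functions *)

Lemma abs_le (R : realDomainType) (s t : R) : - t <= s -> s <= t -> `|s| <= t.
Proof. by move=> h1 h2; rewrite ler_norml h1. Qed.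

Section BoundedLipschitz.
Variables (R : realType) (V : normedModType R).
Implicit Types h : V -> R.

(** Boundedness is included because it makes the class closed under products, hence under polynomial
    expressions. *)
Definition bounded_lipschitz h := exists2 B : R, 0 <= B &
  (forall x, `|h x| <= B) /\ forall x1 x2, `|h x1 - h x2| <= B * `|x1 - x2|.

Lemma bounded_lipschitz_cst c : bounded_lipschitz (fun=> c).
Proof.
exists `|c|; first exact: normr_ge0.
by split=> // x1 x2; rewrite subrr normr0 mulr_ge0.
Qed.

Lemma bounded_lipschitzD h1 h2 : bounded_lipschitz h1 -> bounded_lipschitz h2 ->
  bounded_lipschitz (fun x => h1 x + h2 x).
Proof.
move=> [B1 B10 [b1 l1]] [B2 B20 [b2 l2]]; exists (B1 + B2).
  exact: addr_ge0.
split=> [x|x1 x2]; first by rewrite (le_trans (ler_normD _ _))// lerD.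
by rewrite opprD addrACA mulrDl (le_trans (ler_normD _ _))// lerD.
Qed.

Lemma bounded_lipschitzM h1 h2 : bounded_lipschitz h1 -> bounded_lipschitz h2 ->
  bounded_lipschitz (fun x => h1 x * h2 x).
Proof.
move=> [B1 B10 [b1 l1]] [B2 B20 [b2 l2]]; exists (B1 * B2 + B1 * B2).
  by rewrite addr_ge0 ?mulr_ge0.
split=> [x|x1 x2].
  rewrite normrM (@le_trans _ _ (B1 * B2))// ?ler_pM// lerDl mulr_ge0//.
rewrite (_ : _ - _ = h1 x1 * (h2 x1 - h2 x2) + (h1 x1 - h1 x2) * h2 x2); last by ring.
rewrite (le_trans (ler_normD _ _))// !normrM mulrDl lerD//.
  by rewrite -mulrA ler_pM.
by rewrite mulrAC ler_pM.
Qed.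

Lemma bounded_lipschitzN h : bounded_lipschitz h -> bounded_lipschitz (fun x => - h x).
Proof.
move=> [B B0 [b l1]]; exists B => //.
by split=> [x|x1 x2]; [rewrite normrN|rewrite -opprD normrN].
Qed.

Lemma bounded_lipschitzX h n : bounded_lipschitz h -> bounded_lipschitz (fun x => h x ^+ n).
Proof.
move=> bh; elim: n => [|n IH]; first exact: (bounded_lipschitz_cst 1).
rewrite (_ : (fun _ => _) = fun x => h x * h x ^+ n); first exact: bounded_lipschitzM.
by apply/funext => x; rewrite exprS.
Qed.

End BoundedLipschitz.

(** * The system in adapted coordinates *)

Lemma ord3P (i : 'I_3) : [\/ i = 0, i = 1 | i = 2].
Proof.
by case: i => -[|[|[|//]]] ?; [apply: Or31|apply: Or32|apply: Or33]; apply: val_inj.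
Qed.

Section SUPSystem.
Variables (R : realType) (l : R).

Definition sqrt3 : R := Num.sqrt 3.

Lemma sqrt3_sq : sqrt3 ^+ 2 = 3. Proof. by rewrite sqr_sqrtr. Qed.

Lemma sqrt3_gt0 : 0 < sqrt3. Proof. by rewrite sqrtr_gt0. Qed.

#[local] Hint Resolve sqrt3_gt0 : core.

Local Notation N3 := 'rV[R]_3.

Lemma row3E (b0 b1 b2 : R) :
  (row3 b0 b1 b2 0 0 = b0) * (row3 b0 b1 b2 0 1 = b1) * (row3 b0 b1 b2 0 2 = b2).
Proof. by rewrite /row3 !mxE. Qed.

Lemma rV3P (v w : N3) : v 0 0 = w 0 0 -> v 0 1 = w 0 1 -> v 0 2 = w 0 2 -> v = w.
Proof.
move=> e0 eig1 e2; apply/rowP => i.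
have [->|->|->] := ord3P i.
all: by [].
Qed.

(** As an instance, it lets [is_derive_eq] differentiate polynomials in the coordinates by
    inference. *)
#[local] Instance is_derive_coord (v w : N3) i j :
  is_derive v w (fun x : N3 => x i j) (w i j).
Proof. by have /is_derive_mxP := @is_derive_id R N3 v w; apply. Qed.

Lemma sqrt3V : sqrt3^-1 = sqrt3 / 3.
Proof. by rewrite -sqrt3_sq expr2 invfM mulVKf// gt_eqF. Qed.

(** Denominators are cleared of [sqrt3], so that later identities are algebraic modulo
    [sqrt3_sq]. *)
Definition fieldS (x : N3) : R :=
  - (sqrt3 / 9) - 2 / 3 * x 0 0 + sqrt3 / 3 * x 0 0 ^+ 2
  + sqrt3 / 3 * x 0 1 ^+ 2 + sqrt3 / 6 * x 0 2 ^+ 2 + 2 * x 0 0 ^+ 3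
  - x 0 0 * x 0 1 ^+ 2 + x 0 0 * x 0 2 ^+ 2.
Definition fieldU (x : N3) : R :=
  x 0 1 * (1 / 3 - l / 2 * x 0 2 + 2 * x 0 0 ^+ 2 - x 0 1 ^+ 2 + x 0 2 ^+ 2).
Definition fieldP (x : N3) : R := - (2 / 3) * x 0 2 + l * x 0 1 ^+ 2
  + 2 * x 0 0 ^+ 2 * x 0 2 - x 0 1 ^+ 2 * x 0 2 + x 0 2 ^+ 3.

Lemma SUP_fieldE (x : N3) : SUP_field l x = row3 (fieldS x) (fieldU x) (fieldP x).
Proof.
rewrite /SUP_field -/sqrt3; congr row3; rewrite /fieldS.
by rewrite !div1r !invfM sqrt3V; field.
Qed.

Definition kappa (x : N3) : R := 2 * x 0 0 ^+ 2 - x 0 1 ^+ 2 + x 0 2 ^+ 2 - 2 / 3.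

Definition yco (x : N3) : R := 2 * l * sqrt3 * x 0 0 - 3 * x 0 2 + l.
Definition Gco (x : N3) : R := 2 / 3 - l * x 0 2 - 2 / 3 * sqrt3 * x 0 0.

Definition zco (x : N3) : R := (2 - l ^+ 2) / 2 * x 0 1 ^+ 2
  - (x 0 0 ^+ 2 + x 0 1 ^+ 2 + x 0 2 ^+ 2 / 2 - 1 / 3).

Definition aco (x : N3) : R := 2 * kappa x + 4 / 3 + 2 / 3 * sqrt3 * x 0 0.

Lemma is_derive_yco (x : N3) : is_derive x (SUP_field l x) yco (kappa x * yco x).
Proof.
apply: is_derive_eq; rewrite SUP_fieldE !row3E.
by rewrite /GRing.scale/= /yco /kappa /fieldS /fieldP; field: sqrt3_sq.
Qed.

Lemma is_derive_Gco (x : N3) :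
  is_derive x (SUP_field l x) Gco (kappa x * Gco x + 2 * zco x).
Proof.
apply: is_derive_eq; rewrite SUP_fieldE !row3E.
by rewrite /GRing.scale/= /Gco /zco /kappa /fieldS /fieldP; field: sqrt3_sq.
Qed.

Lemma is_derive_zco (x : N3) : is_derive x (SUP_field l x) zco
  (aco x * zco x + (2 - l ^+ 2) / 2 * x 0 1 ^+ 2 * Gco x).
Proof.
apply: is_derive_eq; rewrite SUP_fieldE !row3E.
by rewrite /GRing.scale/= /aco /Gco /zco /kappa /fieldS /fieldU /fieldP; field: sqrt3_sq.
Qed.

(** * The critical point and the eigenvalues of its linearization *)

Local Notation p := (P3 l).
Definition den := l ^+ 2 + 1.

Definition U3 := p 0 1.

Lemma den_gt0 : 0 < den. Proof. by rewrite ltr_wpDl// sqr_ge0. Qed.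

Lemma den_neq0 : l ^+ 2 + 1 != 0. Proof. exact: lt0r_neq0 den_gt0. Qed.

#[local] Hint Resolve den_gt0 den_neq0 : core.

Lemma P3_S : p 0 0 = sqrt3 * ((2 - l ^+ 2) / (6 * den)).
Proof. by rewrite /P3 row3E -/sqrt3 /den div1r invfM sqrt3V; field. Qed.

Lemma P3_P : p 0 2 = l / den.
Proof. by rewrite /P3 row3E. Qed.

Lemma U3_gt0 : 0 < U3.
Proof.
rewrite /U3 /P3 row3E divr_gt0 ?mulr_gt0 ?sqrtr_gt0//.
by rewrite ltr_wpDl// sqr_ge0.
Qed.

#[local] Hint Resolve U3_gt0 : core.

Lemma U3_sq : U3 ^+ 2 = (l ^+ 2 + 2) / (2 * (l ^+ 2 + 1) ^+ 2).
Proof.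
rewrite /U3 /P3 row3E expr_div_n exprMn !sqr_sqrtr//.
by rewrite addr_ge0// sqr_ge0.
Qed.

Lemma SUP_field_P3 : SUP_field l (P3 l) = 0.
Proof.
rewrite SUP_fieldE; apply: rV3P; rewrite row3E mxE.
- by rewrite /fieldS -/U3 U3_sq P3_S P3_P /den; field: sqrt3_sq.
- by rewrite /fieldU -/U3 U3_sq P3_S P3_P /den; field: sqrt3_sq.
- by rewrite /fieldP -/U3 U3_sq P3_S P3_P /den; field: sqrt3_sq.
Qed.

Lemma is_derive_fieldS (x v : N3) : is_derive x v fieldS
  ((- (2 / 3) + 2 / 3 * sqrt3 * x 0 0 + 6 * x 0 0 ^+ 2 - x 0 1 ^+ 2 + x 0 2 ^+ 2) * v 0 0
   + (2 / 3 * sqrt3 * x 0 1 - 2 * x 0 0 * x 0 1) * v 0 1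
   + (sqrt3 / 3 * x 0 2 + 2 * x 0 0 * x 0 2) * v 0 2).
Proof. by apply: is_derive_eq; rewrite /GRing.scale/=; field. Qed.

Lemma is_derive_fieldU (x v : N3) : is_derive x v fieldU
  (4 * x 0 0 * x 0 1 * v 0 0
   + (1 / 3 - l / 2 * x 0 2 + 2 * x 0 0 ^+ 2 - 3 * x 0 1 ^+ 2 + x 0 2 ^+ 2) * v 0 1
   + x 0 1 * (2 * x 0 2 - l / 2) * v 0 2).
Proof. by apply: is_derive_eq; rewrite /GRing.scale/=; field. Qed.

Lemma is_derive_fieldP (x v : N3) : is_derive x v fieldP
  (4 * x 0 0 * x 0 2 * v 0 0
   + 2 * x 0 1 * (l - x 0 2) * v 0 1
   + (- (2 / 3) + 2 * x 0 0 ^+ 2 - x 0 1 ^+ 2 + 3 * x 0 2 ^+ 2) * v 0 2).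
Proof. by apply: is_derive_eq; rewrite /GRing.scale/=; field. Qed.

Lemma SUP_coordE : ((fun x => SUP_field l x 0 0) = fieldS) *
  ((fun x => SUP_field l x 0 1) = fieldU) * ((fun x => SUP_field l x 0 2) = fieldP).
Proof.
by do !split; apply/funext => x; rewrite SUP_fieldE row3E.
Qed.

Lemma differentiable_SUP (x : N3) : differentiable (SUP_field l) x.
Proof.
apply: differentiable_rVP => j.
have dc i : differentiable (fun x : N3 => x 0 i : R) x by exact: differentiable_coord.
have dcst (c : R) : differentiable (fun _ : N3 => c) x by exact: differentiable_cst.
have [->|->|->] := ord3P j.
- rewrite SUP_coordE; do ![apply: differentiableD|apply: differentiableB|
    apply: differentiableN|apply: differentiableM|apply: differentiableX|
    exact: dc|exact: dcst].
- rewrite SUP_coordE; do ![apply: differentiableD|apply: differentiableB|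
    apply: differentiableN|apply: differentiableM|apply: differentiableX|
    exact: dc|exact: dcst].
- rewrite SUP_coordE; do ![apply: differentiableD|apply: differentiableB|
    apply: differentiableN|apply: differentiableM|apply: differentiableX|
    exact: dc|exact: dcst].
Qed.

Definition eig1 : R := - ((l ^+ 2 + 2) / (2 * (l ^+ 2 + 1))).
(** [tr23] and [det23] are the sum and product of [eps2] and [eps3]. They are real even when these
    are not, so the characteristic polynomial can be computed over the reals first. *)
Definition tr23 : R := - ((l ^+ 2 + 2) / (2 * (l ^+ 2 + 1))).

Definition det23 : R := (l ^+ 2 + 2) * (l ^+ 2 - 2) / (2 * (l ^+ 2 + 1) ^+ 2).

Lemma jacobian_SUP_fieldE i (J := jacobian (SUP_field l) p)
    (v := 'e_i : N3) :
  (J i 0 = (- (2 / 3) + 2 / 3 * sqrt3 * p 0 0 + 6 * p 0 0 ^+ 2 - U3 ^+ 2 + p 0 2 ^+ 2) * v 0 0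
   + (2 / 3 * sqrt3 * U3 - 2 * p 0 0 * U3) * v 0 1
   + (sqrt3 / 3 * p 0 2 + 2 * p 0 0 * p 0 2) * v 0 2) *
  (J i 1 = 4 * p 0 0 * U3 * v 0 0
   + (1 / 3 - l / 2 * p 0 2 + 2 * p 0 0 ^+ 2 - 3 * U3 ^+ 2 + p 0 2 ^+ 2) * v 0 1
   + U3 * (2 * p 0 2 - l / 2) * v 0 2) *
  (J i 2 = 4 * p 0 0 * p 0 2 * v 0 0
   + 2 * U3 * (l - p 0 2) * v 0 1
   + (- (2 / 3) + 2 * p 0 0 ^+ 2 - U3 ^+ 2 + 3 * p 0 2 ^+ 2) * v 0 2).
Proof.
do !split; (apply: jacobianE; first exact: differentiable_SUP);
  rewrite SUP_coordE.
- exact: is_derive_fieldS.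
- exact: is_derive_fieldU.
- exact: is_derive_fieldP.
Qed.

Lemma char_poly_jacobian : char_poly (jacobian (SUP_field l) p) =
  ('X - eig1%:P) * ('X^2 - tr23%:P * 'X + det23%:P).
Proof.
have expand (a1 b1 c1 : R) : a1 = eig1 + tr23 -> b1 = eig1 * tr23 + det23 ->
    c1 = eig1 * det23 -> 'X^3 - a1%:P * 'X^2 + b1%:P * 'X - c1%:P =
    ('X - eig1%:P) * ('X^2 - tr23%:P * 'X + det23%:P).
  by move=> -> -> ->; rewrite !(polyCD, polyCM); ring.
have ec (i j : 'I_3) : ('e_i : N3) 0 j = (j == i)%:R by rewrite mxE.
(* Everything is polynomial in [sqrt3], [l], [i := 1 / den] and [w := 2 U3]. *)
pose i := den^-1; pose w := 2 * U3.
have l2i : l ^+ 2 * i = 1 - i by rewrite /i /den; field.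
have w2 : w ^+ 2 = 2 * i + 2 * i ^+ 2.
  by rewrite /w exprMn U3_sq /i /den; field.
have pS : p 0 0 = sqrt3 * (3 * i - 1) / 6 by rewrite P3_S /i /den; field.
have pP : p 0 2 = l * i by rewrite P3_P.
have pU : U3 = w / 2 by rewrite /w; field.
have eE : eig1 = - (1 + i) / 2 by rewrite /eig1 /i /den; field.
have tE : tr23 = - (1 + i) / 2 by rewrite /tr23 /i /den; field.
have dE : det23 = (1 + i) * (1 - 3 * i) / 2 by rewrite /det23 /i /den; field.
rewrite char_poly3 !jacobian_SUP_fieldE !ec /=.
move: eE tE dE w2 l2i pS pP pU.
move: (i) (w) (eig1) (tr23) (det23) (p 0 0) (p 0 2) (U3) expand.
move=> {}i {}w E T D S P U expand eE tE dE w2 l2i -> -> ->.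
apply: expand; rewrite ?eE ?tE ?dE.
- by field: sqrt3_sq w2 l2i.
- by field: sqrt3_sq w2 l2i.
- by field: sqrt3_sq w2 l2i.
Qed.

Local Notation eigs := [:: eps1 l; eps2 l; eps3 l].

Lemma char_poly_linearization :
  char_poly (linearization (SUP_field l) (P3 l)) =
  \prod_(x <- eigs) ('X - x%:P).
Proof.
have mapE (E T D : R) : map_poly (real_complex R)
      (('X - E%:P) * ('X^2 - T%:P * 'X + D%:P)) =
    ('X - (real_complex R E)%:P) *
      ('X^2 - (real_complex R T)%:P * 'X + (real_complex R D)%:P).
  by rewrite !(rmorphM, rmorphD, rmorphN) /= !map_polyX !map_polyC.
rewrite /linearization -map_char_poly char_poly_jacobian mapE.
rewrite !big_cons big_nil mulr1.
have kC : (real_complex R l) ^+ 2 + 1 != 0.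
  by rewrite -rmorphXn -(rmorph1 (real_complex R)) -rmorphD fmorph_eq0.
have eC1 : real_complex R eig1 = eps1 l.
  rewrite /eps1 /eig1.
  by rewrite !(rmorphN, rmorphM, fmorphV, rmorphD, rmorphXn, rmorph_nat, rmorph1).
have sum23 : real_complex R tr23 = eps2 l + eps3 l.
  rewrite /eps2 /eps3 /tr23.
  rewrite !(rmorphN, rmorphM, fmorphV, rmorphD, rmorphXn, rmorph_nat, rmorph1).
  by field.
have prod23 : real_complex R det23 = eps2 l * eps3 l.
  rewrite /eps2 /eps3 /det23.
  (* Only the square of w enters the product, so no case distinction on the sign of 18 - 7 l^2 is
     needed. *)
  set w := sqrtC _.
  have w2 : w ^+ 2 =
      (18 - 7 * (real_complex R l) ^+ 2) * ((real_complex R l) ^+ 2 + 2).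
    exact: sqrtCK.
  rewrite !(rmorphN, rmorphM, fmorphV, rmorphD, rmorphXn, rmorph_nat, rmorph1).
  by field: w2.
transitivity (('X - (eps1 l)%:P) *
    ('X^2 - (eps2 l + eps3 l)%:P * 'X + (eps2 l * eps3 l)%:P)).
  by rewrite -eC1 -sum23 -prod23.
have viete (K : comNzRingType) (b c : K) :
    'X^2 - (b + c)%:P * 'X + (b * c)%:P = ('X - b%:P) * ('X - c%:P).
  by rewrite polyCD polyCM; ring.
by rewrite viete.
Qed.

Lemma eigenvalue_linearization (x : complex R) :
  eigenvalue (linearization (SUP_field l) (P3 l)) x = (x \in eigs).
Proof. by rewrite eigenvalue_root_char char_poly_linearization root_prod_XsubC. Qed.

(** * Values at the critical point and quadratic functions of the adapted coordinates *)

Definition rate : R := (l ^+ 2 + 2) / (2 * den).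

Definition Wco (x : N3) : R := (2 - l ^+ 2) / 2 * x 0 1 ^+ 2.

Lemma kappa_P3 : kappa p = - rate.
Proof. by rewrite /kappa -/U3 U3_sq P3_S P3_P /rate /den; field: sqrt3_sq. Qed.

Lemma aco_P3 : aco p = 0.
Proof. by rewrite /aco kappa_P3 P3_S /rate /den; field: sqrt3_sq. Qed.

Lemma Wco_P3 : Wco p = (2 - l ^+ 2) * (l ^+ 2 + 2) / (4 * den ^+ 2).
Proof. by rewrite /Wco -/U3 U3_sq /den; field. Qed.

Lemma yco_P3 : yco p = 0.
Proof. by rewrite /yco P3_S P3_P /den; field: sqrt3_sq. Qed.

Lemma Gco_P3 : Gco p = 0.
Proof. by rewrite /Gco P3_S P3_P /den; field: sqrt3_sq. Qed.

Lemma zco_P3 : zco p = 0.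
Proof. by rewrite /zco -/U3 U3_sq P3_S P3_P /den; field: sqrt3_sq. Qed.

Ltac diff_poly := do ![exact: differentiable_coord|exact: differentiable_cst|
  apply: differentiableD|apply: differentiableB|
  apply: differentiableN|apply: differentiableM|apply: differentiableX].

Lemma differentiable_yco (x : N3) : differentiable yco x. Proof. by diff_poly. Qed.

Lemma differentiable_Gco (x : N3) : differentiable Gco x. Proof. by diff_poly. Qed.

Lemma differentiable_zco (x : N3) : differentiable zco x. Proof. by diff_poly. Qed.

Lemma differentiable_kappa (x : N3) : differentiable kappa x. Proof. by diff_poly. Qed.

Lemma differentiable_Wco (x : N3) : differentiable Wco x. Proof. by diff_poly. Qed.

Lemma differentiable_aco (x : N3) : differentiable aco x.
Proof. by rewrite /aco; diff_poly. Qed.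

(** One family containing the Chetaev functions of the saddle and center cases and the Lyapunov
    function of the sink, so that the derivative is computed once. *)
Definition quadco (c1 c2 c3 c4 c5 : R) (x : N3) : R :=
  c1 * yco x ^+ 2 + c2 * zco x ^+ 2
  + c3 * Gco x ^+ 2 + c4 * (Gco x * zco x) + c5 * zco x.

Lemma differentiable_quadco c1 c2 c3 c4 c5 x :
  differentiable (quadco c1 c2 c3 c4 c5) x.
Proof.
by rewrite /quadco; do ![exact: differentiable_yco|exact: differentiable_Gco|
  exact: differentiable_zco|exact: differentiable_cst|
  apply: differentiableD|apply: differentiableB|
  apply: differentiableN|apply: differentiableM|apply: differentiableX].
Qed.

Lemma derive_quadco c1 c2 c3 c4 c5 (x : N3) :
  'D_(SUP_field l x) (quadco c1 c2 c3 c4 c5) x =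
  c1 * (2 * yco x * (kappa x * yco x))
  + c2 * (2 * zco x * (aco x * zco x + Wco x * Gco x))
  + c3 * (2 * Gco x * (kappa x * Gco x + 2 * zco x))
  + c4 * ((kappa x * Gco x + 2 * zco x) * zco x + Gco x * (aco x * zco x + Wco x * Gco x))
  + c5 * (aco x * zco x + Wco x * Gco x).
Proof.
(* Abstract functions keep inference from unfolding the coordinates down to S, U and P. *)
have gen (y' G' z' : N3 -> R) v dy dG dz : is_derive x v y' dy ->
    is_derive x v G' dG -> is_derive x v z' dz ->
    is_derive x v (fun x => c1 * y' x ^+ 2 + c2 * z' x ^+ 2
      + c3 * G' x ^+ 2 + c4 * (G' x * z' x) + c5 * z' x)
    (c1 * (2 * y' x * dy) + c2 * (2 * z' x * dz) + c3 * (2 * G' x * dG)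
     + c4 * (dG * z' x + G' x * dz) + c5 * dz).
  by move=> ? ? ?; apply: is_derive_eq; rewrite /GRing.scale/=; ring.
by have [] := gen _ _ _ _ _ _ _ (is_derive_yco x) (is_derive_Gco x) (is_derive_zco x).
Qed.

Lemma near_P3 (h : N3 -> R) (c e : R) : (forall x, differentiable h x) -> h p = c ->
  0 < e -> exists2 r : R, 0 < r & forall x, `|x - p| < r -> `|h x - c| <= e.
Proof.
move=> dh <- e0; have cp : {for p, continuous h} by exact/differentiable_continuous.
have [r r0 hr] := continuous_ball cp e0; exists r => // x /hr; exact: ltW.
Qed.

(** Supplies the smallness hypotheses of the quadratic estimates, with tau = [rate] and the value of
    W at P3 equal to d for the saddle, - d for the sink. *)
Lemma near_coefficients (e : R) : 0 < e -> exists2 r : R, 0 < r &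
  forall x, `|x - p| < r -> [/\ `|aco x| <= e, `|kappa x + rate| <= e &
    `|Wco x - (2 - l ^+ 2) * (l ^+ 2 + 2) / (4 * den ^+ 2)| <= e].
Proof.
move=> e0.
have [r1 r10 h1] := near_P3 differentiable_aco aco_P3 e0.
have [r2 r20 h2] := near_P3 differentiable_kappa kappa_P3 e0.
have [r3 r30 h3] := near_P3 differentiable_Wco Wco_P3 e0.
exists (Num.min r1 (Num.min r2 r3)); first by rewrite !lt_min r10 r20 r30.
move=> x; rewrite !lt_min => /and3P[/h1 + /h2 + /h3 +].
by rewrite subr0 opprK; split.
Qed.

Lemma rate_ge_half : 1 / 2 <= rate.
Proof.
rewrite /rate ler_pdivlMr; last by rewrite mulr_gt0.
by rewrite /den; lra.
Qed.

Lemma row3_near_P3 (S U P e : R) : 0 < e -> `|S - p 0 0| < e -> `|U - p 0 1| < e ->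
  `|P - p 0 2| < e -> `|row3 S U P - p| < e.
Proof.
move=> e0 hS hU hP.
pose m := Num.max `|S - p 0 0| (Num.max `|U - p 0 1| `|P - p 0 2|).
apply: (@le_lt_trans _ _ m); last by rewrite /m !gt_max hS hU hP.
apply: norm_le_coord => [|i j]; first by rewrite /m le_max normr_ge0.
rewrite ord1; have [->|->|->] := ord3P j.
- by rewrite [X in `|X|]mxE [X in `|_ + X|]mxE row3E /m !le_max lexx.
- by rewrite [X in `|X|]mxE [X in `|_ + X|]mxE row3E /m !le_max lexx orbT.
- by rewrite [X in `|X|]mxE [X in `|_ + X|]mxE row3E /m !le_max lexx !orbT.
Qed.
(** * Instability for [l ^+ 2 <= 2] *)

Lemma Gco_row3 (S U P : R) : Gco (row3 S U P) = 2 / 3 - l * P - 2 / 3 * sqrt3 * S.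
Proof. by rewrite /Gco !row3E. Qed.

Lemma yco_row3 (S U P : R) : yco (row3 S U P) = 2 * l * sqrt3 * S - 3 * P + l.
Proof. by rewrite /yco !row3E. Qed.

Lemma zco_row3 (S U P : R) : zco (row3 S U P) =
  (2 - l ^+ 2) / 2 * U ^+ 2 - (S ^+ 2 + U ^+ 2 + P ^+ 2 / 2 - 1 / 3).
Proof. by rewrite /zco !row3E. Qed.

Lemma unstable_saddle : 0 <= l -> l ^+ 2 < 2 -> unstable (SUP_field l) (P3 l).
Proof.
move=> l0 l2; pose d := (2 - l ^+ 2) * (l ^+ 2 + 2) / (4 * den ^+ 2).
have ll0 : 0 <= l ^+ 2 := sqr_ge0 l.
have d0 : 0 < d by rewrite divr_gt0 ?mulr_gt0 ?exprn_gt0//; lra.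
have d1 : d <= 1.
  by rewrite /d ler_pdivrMr ?mulr_gt0 ?exprn_gt0// /den; nra.
have tau1 : rate <= 1 by rewrite /rate ler_pdivrMr ?mulr_gt0// /den; lra.
have tau_itv : 1 / 2 <= rate <= 1 by rewrite rate_ge_half.
have d_itv : 0 < d <= 1 by rewrite d0.
pose Y := quadco 0 rate (- (d * rate / 2)) (4 * d) 0.
have dY x : differentiable Y x by exact: differentiable_quadco.
have Yp : Y p = 0 by rewrite /Y /quadco yco_P3 zco_P3 Gco_P3; ring.
have YE x : Y x = rate * zco x ^+ 2 - d * rate / 2 * Gco x ^+ 2 + 4 * d * (Gco x * zco x).
  by rewrite /Y /quadco; ring.
have e0 : 0 < d / 320 by lra.
have [r1 r10 h1] := near_coefficients e0.
have [r2 r20 h2] := near_P3 dY Yp ltr01.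
(* The constant is d / 32 from [saddle_estimate] divided by 3 from [saddle_upper]; the radius [r2]
   ensures |Y| <= 1, so that Y^2 <= Y where Y > 0. *)
apply: (@chetaev_unstable _ _ Y p dY (SUP_field l) (d / 96) (Num.min r1 r2)).
- by rewrite divr_gt0.
- by rewrite lt_min r10.
- move=> x; rewrite lt_min => /andP[/h1[ha hk hw] /h2]; rewrite subr0 => Y1.
  have DY : 'D_(SUP_field l x) Y x =
      rate * (2 * zco x * (aco x * zco x + Wco x * Gco x))
      - d * rate / 2 * (2 * Gco x * (kappa x * Gco x + 2 * zco x))
      + 4 * d * ((kappa x * Gco x + 2 * zco x) * zco x + Gco x * (aco x * zco x + Wco x * Gco x)).
    by rewrite derive_quadco; ring.
  have est := saddle_estimate (Gco x) (zco x) tau_itv d_itv erefl ha hk hw.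
  rewrite -DY in est.
  have up := saddle_upper (Gco x) (zco x) tau_itv d_itv; rewrite -YE in up.
  have G2 := sqr_ge0 (Gco x); have z2 := sqr_ge0 (zco x).
  split.
    apply: le_trans est; apply: mulr_ge0; last exact: addr_ge0.
    by rewrite divr_ge0// ltW.
  move=> Y0; apply: le_trans est.
  have Y2 : Y x ^+ 2 <= Y x.
    by rewrite expr2 ler_piMl// ?(ltW Y0)// (le_trans (ler_norm _)).
  have d96 : 0 <= d / 96 by rewrite divr_ge0// ltW.
  rewrite (_ : d / 32 * _ = d / 96 * (3 * (Gco x ^+ 2 + zco x ^+ 2))); last by field.
  exact: ler_wpM2l d96 _ _ (le_trans Y2 up).
- move=> e ee0; pose h := Num.min e 1 / 2.
  have m0 : 0 < Num.min e 1 by rewrite lt_min ee0 ltr01.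
  have h0 : 0 < h by rewrite divr_gt0.
  have he : `|h| < e.
    rewrite gtr0_norm// (@lt_le_trans _ _ (Num.min e 1))//; last by rewrite ge_min lexx.
    by rewrite /h; lra.
  (* Moving U alone keeps G = 0 and makes z nonzero, so Y = [rate] z^2 > 0. But U^2 enters z with
     coefficient - l^2 / 2, so for l = 0 the coordinate S is moved instead. *)
  have [l_eq0|l_neq0] := eqVneq l 0.
    exists (row3 (p 0 0 + h) (p 0 1) (p 0 2)).
      by apply: row3_near_P3; rewrite ?subrr ?normr0// addrC addKr.
    rewrite YE.
    have S0 : p 0 0 = sqrt3 / 3 by rewrite P3_S /den l_eq0; field.
    have P0 : p 0 2 = 0 by rewrite P3_P l_eq0 mul0r.
    have U02 : p 0 1 ^+ 2 = 1 by rewrite -/U3 U3_sq l_eq0; field.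
    have -> : Gco (row3 (p 0 0 + h) (p 0 1) (p 0 2)) = - (2 / 3 * sqrt3 * h).
      by rewrite Gco_row3 P0 S0 l_eq0; field: sqrt3_sq.
    have -> : zco (row3 (p 0 0 + h) (p 0 1) (p 0 2)) = - (2 / 3 * sqrt3 * h + h ^+ 2).
      by rewrite zco_row3 P0 S0 U02 l_eq0; field: sqrt3_sq.
    have -> : d = 1 by rewrite /d /den l_eq0; field.
    have -> : rate = 1 by rewrite /rate /den l_eq0; field.
    set g := 2 / 3 * sqrt3 * h.
    have g0 : 0 < g by rewrite !mulr_gt0.
    have gh : 0 < g * h ^+ 2 by rewrite mulr_gt0// exprn_gt0.
    have hh : 0 <= (g + h ^+ 2) ^+ 2 by exact: sqr_ge0.
    have gg : 0 < g ^+ 2 by exact: exprn_gt0.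
    nra.
  exists (row3 (p 0 0) (p 0 1 + h) (p 0 2)).
    by apply: row3_near_P3; rewrite ?subrr ?normr0// addrC addKr.
  rewrite YE.
  have -> : Gco (row3 (p 0 0) (p 0 1 + h) (p 0 2)) = 0.
    by rewrite Gco_row3 -[RHS]Gco_P3.
  have -> : zco (row3 (p 0 0) (p 0 1 + h) (p 0 2)) =
      - (l ^+ 2 / 2 * (2 * U3 * h + h ^+ 2)).
    by rewrite zco_row3 -[LHS]subr0 -zco_P3 /zco -/U3; field.
  set s := l ^+ 2 / 2 * (2 * U3 * h + h ^+ 2).
  rewrite [X in _ < X](_ : _ = rate * s ^+ 2); last by ring.
  rewrite mulr_gt0//; first by lra.
  rewrite exprn_gt0// !mulr_gt0 ?invr_gt0 ?addr_gt0 ?exprn_gt0 ?mulr_gt0//.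
  all: by rewrite lt_neqAle eq_sym l_neq0.
Qed.

Lemma unstable_center : l ^+ 2 = 2 -> 0 <= l -> unstable (SUP_field l) (P3 l).
Proof.
move=> l2 l0; have l_itv : 0 <= l <= 3 / 2 by rewrite l0/=; nra.
have U2 : p 0 1 ^+ 2 = 2 / 9 by rewrite -/U3 U3_sq l2; field.
have S0 : p 0 0 = 0 by rewrite P3_S l2; field.
have P0 : p 0 2 = l / 3 by rewrite P3_P /den l2; field.
have tauE : rate = 2 / 3 by rewrite /rate /den l2; field.
pose Y := quadco (- 2) (- 18) (- 2) 12 (- 1).
have dY x : differentiable Y x by exact: differentiable_quadco.
have YE x : Y x = - zco x - 2 * (yco x ^+ 2 + (Gco x - 3 * zco x) ^+ 2).
  by rewrite /Y /quadco; ring.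
have e0 : 0 < 1 / 100 :> R by lra.
(* With |S| and |P - l / 3| below 1/1000, the remainder [th] is at most (6 + 3) / 1000 times |y| +
   |G|, within the 1/100 that [center_estimate] allows. *)
have e0' : 0 < 1 / 1000 :> R by lra.
have [r1 r10 h1] := near_coefficients e0.
have dS (i : 'I_3) (x : N3) : differentiable (fun x : N3 => x 0 i : R) x.
  exact: differentiable_coord.
have [r2 r20 h2] := near_P3 (dS 0) S0 e0'.
have [r3 r30 h3] := near_P3 (dS 2) P0 e0'.
apply: (@chetaev_unstable _ _ Y p dY (SUP_field l) 1
  (Num.min r1 (Num.min r2 r3))) => //.
- by rewrite !lt_min r10 r20 r30.
- move=> x; rewrite !lt_min => /and3P[/h1[ha hk _] /h2 hS /h3 hP].
  rewrite tauE in hk; rewrite subr0 in hS.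
  (* The second-order remainder of [aco] in the adapted coordinates. It depends on S and P only,
     which are affine in y and G, so it vanishes along y = G = 0 whatever z is. *)
  pose th := 6 * x 0 0 ^+ 2 + 3 * (x 0 2 - l / 3) ^+ 2.
  have aE : aco x = 2 * zco x - 5 / 3 * Gco x - l / 9 * yco x + th.
    by rewrite /aco /zco /Gco /yco /kappa /th; field: sqrt3_sq l2.
  have SE : sqrt3 * x 0 0 = (l * yco x - 3 * Gco x) / 6.
    by rewrite /Gco /yco; field: l2.
  have PE : x 0 2 - l / 3 = - (l * Gco x + yco x / 3) / 3.
    by rewrite /Gco /yco; field: l2.
  have ly : `|l * yco x| <= 3 / 2 * `|yco x|.
    by rewrite normrM (ger0_norm l0) ler_wpM2r//; case/andP: l_itv.
  have lG : `|l * Gco x| <= 3 / 2 * `|Gco x|.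
    by rewrite normrM (ger0_norm l0) ler_wpM2r//; case/andP: l_itv.
  have Sb : `|x 0 0| <= `|yco x| + `|Gco x|.
    have : `|x 0 0| <= `|sqrt3 * x 0 0|.
      rewrite normrM ler_peMl// (le_trans _ (ler_norm _))//.
      rewrite -(@ler_pXn2r _ 2) ?nnegrE// ?(ltW sqrt3_gt0)// sqrt3_sq expr1n; lra.
    move=> /le_trans; apply; rewrite SE normrM (@ger0_norm _ 6^-1)//.
    have := ler_normB (l * yco x) (3 * Gco x); rewrite (normrM 3) (@ger0_norm _ 3)//.
    have := normr_ge0 (yco x); have := normr_ge0 (Gco x); lra.
  have Pb : `|x 0 2 - l / 3| <= `|yco x| + `|Gco x|.
    rewrite PE normrM normrN (@ger0_norm _ 3^-1)//.
    have := ler_normD (l * Gco x) (yco x / 3); rewrite (normrM _ 3^-1) (@ger0_norm _ 3^-1)//.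
    have := normr_ge0 (yco x); have := normr_ge0 (Gco x); lra.
  have thb : `|th| <= 1 / 100 * (`|yco x| + `|Gco x|).
    rewrite ger0_norm; last by rewrite addr_ge0// mulr_ge0// sqr_ge0.
    rewrite /th -(real_normK (num_real (x 0 0))) -(real_normK (num_real (x 0 2 - l / 3))).
    have S1 := ler_pM (normr_ge0 _) (normr_ge0 _) hS Sb.
    have P1 := ler_pM (normr_ge0 _) (normr_ge0 _) hP Pb.
    move: S1 P1; rewrite -!expr2.
    have := normr_ge0 (yco x); have := normr_ge0 (Gco x); lra.
  have est := center_estimate l_itv erefl aE ha hk thb.
  have DY : 'D_(SUP_field l x) Y x =
     - 2 * (2 * yco x * (kappa x * yco x)) - 18 * (2 * zco x * (aco x * zco x))
     - 2 * (2 * Gco x * (kappa x * Gco x + 2 * zco x))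
     + 12 * ((kappa x * Gco x + 2 * zco x) * zco x + Gco x * (aco x * zco x)) - aco x * zco x.
    by rewrite derive_quadco /Wco l2; ring.
  rewrite -DY in est.
  have y2 := sqr_ge0 (yco x); have g2 := sqr_ge0 (Gco x - 3 * zco x).
  have z2 := sqr_ge0 (zco x).
  split; first by apply: le_trans est; rewrite !addr_ge0.
  move=> Y0; rewrite mul1r; apply: le_trans est.
  (* Hence 0 < Y <= - z and Y^2 <= z^2, which the derivative dominates. *)
  have Yz : Y x <= - zco x by rewrite YE lerBlDr lerDl mulr_ge0// addr_ge0.
  apply: (@le_trans _ _ ((- zco x) ^+ 2)).
    by rewrite ler_sqr ?nnegrE ?(ltW Y0)// (le_trans (ltW Y0)).
  by rewrite sqrrN lerDr addr_ge0.
- move=> e ee0; pose h := Num.min e (1 / 100) / 2.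
  have m0 : 0 < Num.min e (1 / 100) by rewrite lt_min ee0.
  have h0 : 0 < h by rewrite divr_gt0.
  have he : `|h| < e.
    rewrite gtr0_norm// (@lt_le_trans _ _ (Num.min e (1 / 100)))//; last by rewrite ge_min lexx.
    by rewrite /h; lra.
  have h1' : h <= 1 / 100.
    rewrite (@le_trans _ _ (Num.min e (1 / 100)))//; last by rewrite ge_min lexx orbT.
    by rewrite /h; lra.
  (* Raising U leaves y = G = 0 and gives z = - s with s > 0, so Y = s - 18 s^2, positive because s
     < 1/18. *)
  exists (row3 (p 0 0) (p 0 1 + h) (p 0 2)).
    by apply: row3_near_P3; rewrite ?subrr ?normr0// addrC addKr.
  rewrite YE.
  have -> : Gco (row3 (p 0 0) (p 0 1 + h) (p 0 2)) = 0.
    by rewrite Gco_row3 -[RHS]Gco_P3.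
  have -> : yco (row3 (p 0 0) (p 0 1 + h) (p 0 2)) = 0.
    by rewrite yco_row3 -[RHS]yco_P3.
  have -> : zco (row3 (p 0 0) (p 0 1 + h) (p 0 2)) = - (2 * U3 * h + h ^+ 2).
    by rewrite zco_row3 -[LHS]subr0 -zco_P3 /zco -/U3; field: l2.
  set s := 2 * U3 * h + h ^+ 2.
  have U01 : U3 <= 1 / 2.
    rewrite -(@ler_pXn2r _ 2) ?nnegrE ?(ltW U3_gt0)//.
    by rewrite -/U3 in U2; rewrite U2; lra.
  have s0 : 0 < s by rewrite addr_gt0 ?exprn_gt0// !mulr_gt0.
  have s1 : s < 1 / 18.
    have : U3 * h <= 1 / 2 * h by rewrite ler_wpM2r// ltW.
    have : h ^+ 2 <= 1 / 100 * h by rewrite expr2 ler_wpM2r// ltW.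
    rewrite /s; lra.
  have : s * s < 1 / 18 * s by rewrite ltr_pM2r.
  nra.
Qed.
(** * Asymptotic stability for [l ^+ 2 > 2] *)

Definition clip (i : 'I_3) (t : R) : R :=
  Num.max (p 0 i - 1) (Num.min (p 0 i + 1) t).

Definition clipped (x : N3) : N3 :=
  row3 (clip 0 (x 0 0)) (clip 1 (x 0 1)) (clip 2 (x 0 2)).

Lemma bounded_lipschitz_clip i : bounded_lipschitz (fun x : N3 => clip i (x 0 i)).
Proof.
have clip_itv t : p 0 i - 1 <= clip i t <= p 0 i + 1.
  rewrite /clip le_max lexx/= ge_max ge_min lexx/= andbT; lra.
exists (`|p 0 i| + 1); first by rewrite addr_ge0.
split=> [x|x1 x2].
  have /andP[h1 h2] := clip_itv (x 0 i); have h3 := ler_norm (p 0 i).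
  have h4 := ler_norm (- p 0 i); rewrite normrN in h4.
  by apply: abs_le; lra.
have clipE (t : R) : [\/ t <= p 0 i - 1 /\ clip i t = p 0 i - 1,
    p 0 i - 1 <= t <= p 0 i + 1 /\ clip i t = t |
    p 0 i + 1 <= t /\ clip i t = p 0 i + 1].
  rewrite /clip; have [t_lo|lo_t] := leP t (p 0 i - 1).
    apply: Or31; split => //; rewrite min_r; last by lra.
    by rewrite max_l.
  have [hi_t|t_hi] := leP (p 0 i + 1) t.
    by apply: Or33; split => //; rewrite max_r//; lra.
  by apply: Or32; rewrite max_r ?(ltW lo_t) ?(ltW t_hi).
have clip1 (s t : R) : `|clip i s - clip i t| <= `|s - t|.
  have d1 := ler_norm (s - t); have d2 := ler_norm (- (s - t)).
  rewrite normrN in d2.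
  have [[? ->]|[/andP[? ?] ->]|[? ->]] := clipE s;
  have [[? ->]|[/andP[? ?] ->]|[? ->]] := clipE t; apply: abs_le; lra.
rewrite (le_trans (clip1 _ _))// (@le_trans _ _ `|x1 - x2|)//.
  by rewrite (_ : _ - _ = (x1 - x2) 0 i) ?coord_le_norm// !mxE.
by rewrite ler_peMl// lerDr.
Qed.

Lemma clip_id (x : N3) : `|x - p| < 1 -> clipped x = x.
Proof.
move=> xp.
have c i : clip i (x 0 i) = x 0 i.
  have : `|x 0 i - p 0 i| < 1.
    apply: le_lt_trans xp.
    by rewrite (_ : _ - _ = (x - p) 0 i) ?coord_le_norm// !mxE.
  rewrite ltr_norml => /andP[h1 h2].
  by rewrite /clip min_r ?max_r//; lra.
by apply: rV3P; rewrite /clipped row3E c.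
Qed.

(** Each component is a polynomial in the clipped coordinates, which are bounded and Lipschitz. *)
Lemma clipped_lipschitz : exists2 L : R, 0 <= L & forall x1 x2,
  `|SUP_field l (clipped x1) - SUP_field l (clipped x2)| <= L * `|x1 - x2|.
Proof.
have bl_c : bounded_lipschitz (fun x : N3 => clip 0 (x 0 0)) by exact: bounded_lipschitz_clip.
have bl_c1 : bounded_lipschitz (fun x : N3 => clip 1 (x 0 1)) by exact: bounded_lipschitz_clip.
have bl_c2 : bounded_lipschitz (fun x : N3 => clip 2 (x 0 2)) by exact: bounded_lipschitz_clip.
have [B0 B00 [_ l0]] : bounded_lipschitz (fun x : N3 => fieldS (clipped x)).
  rewrite (_ : (fun _ => _) = fun x : N3 => - (sqrt3 / 9) - 2 / 3 * clip 0 (x 0 0)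
    + sqrt3 / 3 * clip 0 (x 0 0) ^+ 2 + sqrt3 / 3 * clip 1 (x 0 1) ^+ 2
    + sqrt3 / 6 * clip 2 (x 0 2) ^+ 2 + 2 * clip 0 (x 0 0) ^+ 3
    - clip 0 (x 0 0) * clip 1 (x 0 1) ^+ 2
    + clip 0 (x 0 0) * clip 2 (x 0 2) ^+ 2).
    by do ![exact: bl_c|exact: bl_c1|exact: bl_c2|exact: bounded_lipschitz_cst|
      apply: bounded_lipschitzD|apply: bounded_lipschitzN|apply: bounded_lipschitzX|apply: bounded_lipschitzM].
  by apply/funext => x; rewrite /fieldS /clipped !row3E.
have [B1 B10 [_ l1]] : bounded_lipschitz (fun x : N3 => fieldU (clipped x)).
  rewrite (_ : (fun _ => _) = fun x : N3 => clip 1 (x 0 1) *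
    (1 / 3 - l / 2 * clip 2 (x 0 2) + 2 * clip 0 (x 0 0) ^+ 2
     - clip 1 (x 0 1) ^+ 2 + clip 2 (x 0 2) ^+ 2)).
    by do ![exact: bl_c|exact: bl_c1|exact: bl_c2|exact: bounded_lipschitz_cst|
      apply: bounded_lipschitzD|apply: bounded_lipschitzN|apply: bounded_lipschitzX|apply: bounded_lipschitzM].
  by apply/funext => x; rewrite /fieldU /clipped !row3E.
have [B2 B20 [_ l2]] : bounded_lipschitz (fun x : N3 => fieldP (clipped x)).
  rewrite (_ : (fun _ => _) = fun x : N3 => - (2 / 3) * clip 2 (x 0 2)
    + l * clip 1 (x 0 1) ^+ 2 + 2 * clip 0 (x 0 0) ^+ 2 * clip 2 (x 0 2)
    - clip 1 (x 0 1) ^+ 2 * clip 2 (x 0 2) + clip 2 (x 0 2) ^+ 3).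
    by do ![exact: bl_c|exact: bl_c1|exact: bl_c2|exact: bounded_lipschitz_cst|
      apply: bounded_lipschitzD|apply: bounded_lipschitzN|apply: bounded_lipschitzX|apply: bounded_lipschitzM].
  by apply/funext => x; rewrite /fieldP /clipped !row3E.
exists (B0 + B1 + B2); first by rewrite !addr_ge0.
move=> x1 x2; apply: norm_le_coord; first by rewrite mulr_ge0// !addr_ge0.
have n0 := normr_ge0 (x1 - x2).
have [m0 m1 m2] : [/\ 0 <= B0 * `|x1 - x2|, 0 <= B1 * `|x1 - x2| & 0 <= B2 * `|x1 - x2|].
  by rewrite !mulr_ge0.
move=> i j; rewrite ord1 !SUP_fieldE.
have [->|->|->] := ord3P j.
- rewrite [X in `|X|]mxE [X in `|_ + X|]mxE !row3E (le_trans (l0 _ _))//; lra.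
- rewrite [X in `|X|]mxE [X in `|_ + X|]mxE !row3E (le_trans (l1 _ _))//; lra.
- rewrite [X in `|X|]mxE [X in `|_ + X|]mxE !row3E (le_trans (l2 _ _))//; lra.
Qed.

(** The coordinates y and G determine S and P by an invertible affine map; then z determines U^2,
    whose coefficient - l^2 / 2 is nonzero, and U follows from U^2 since U is positive at P3. *)
Lemma coordinates_control : 2 < l ^+ 2 -> exists2 C : R, 0 <= C &
  exists2 r : R, 0 < r & forall x, `|x - p| < r ->
    `|x - p| ^+ 2 <= C * (yco x ^+ 2 + Gco x ^+ 2 + zco x ^+ 2).
Proof.
move=> l2; have dc (i : 'I_3) (x : N3) : differentiable (fun x : N3 => x 0 i : R) x.
  exact: differentiable_coord.
have k3 : 3 <= den by rewrite /den; lra.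
have [r1 r10 h1] := near_P3 (dc 0) erefl ltr01.
have [r2 r20 h2] := near_P3 (dc 1) erefl U3_gt0.
have [r3 r30 h3] := near_P3 (dc 2) erefl ltr01.
exists (5 + 2 + 153 / U3 ^+ 2).
  by rewrite !addr_ge0// divr_ge0// exprn_ge0// ltW.
exists (Num.min r1 (Num.min r2 r3)); first by rewrite !lt_min r10 r20 r30.
move=> x; rewrite !lt_min => /and3P[/h1 hS /h2 hU /h3 hP].
pose q := yco x ^+ 2 + Gco x ^+ 2 + zco x ^+ 2.
pose i := den^-1; have ki : den * i = 1 by rewrite divff// gt_eqF.
have i0 : 0 < i by rewrite invr_gt0.
have l2i : l ^+ 2 * i = 1 - i by rewrite /i /den; field.
have i3 : i <= 1 / 3 by nra.
have y2 := sqr_ge0 (yco x); have G2 := sqr_ge0 (Gco x); have z2 := sqr_ge0 (zco x).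
have SE : sqrt3 * (x 0 0 - p 0 0) = (l * i * yco x - 3 * i * Gco x) / 2.
  by rewrite P3_S /yco /Gco /i /den; field: sqrt3_sq.
have PE : x 0 2 - p 0 2 = - (l * i * Gco x + i * yco x / 3).
  by rewrite P3_P /yco /Gco /i /den; field.
have li : (l * i) ^+ 2 <= 1 / 3.
  by rewrite exprMn expr2 mulrA l2i; nra.
have S_q : (x 0 0 - p 0 0) ^+ 2 <= 5 * q.
  have : 3 * (x 0 0 - p 0 0) ^+ 2 = ((l * i * yco x - 3 * i * Gco x) / 2) ^+ 2.
    by rewrite -SE exprMn sqrt3_sq.
  have u1 : (l * i) ^+ 2 * yco x ^+ 2 <= 1 / 3 * yco x ^+ 2 by rewrite ler_wpM2r.
  have u2 : (3 * i) ^+ 2 * Gco x ^+ 2 <= 1 * Gco x ^+ 2.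
    by rewrite ler_wpM2r// expr_le1//; lra.
  have := sqr_ge0 (l * i * yco x + 3 * i * Gco x); rewrite /q; nra.
have P_q : (x 0 2 - p 0 2) ^+ 2 <= 2 * q.
  have u1 : (l * i) ^+ 2 * Gco x ^+ 2 <= 1 / 3 * Gco x ^+ 2 by rewrite ler_wpM2r.
  have u2 : (i / 3) ^+ 2 * yco x ^+ 2 <= 1 * yco x ^+ 2.
    by rewrite ler_wpM2r// expr_le1//; lra.
  have := sqr_ge0 (l * i * Gco x - i / 3 * yco x); rewrite PE /q; nra.
have p0_le : `|p 0 0| <= 1.
  rewrite P3_S -/i (_ : _ * _ = sqrt3 * ((3 * i - 1) / 6)); last first.
    by rewrite /i /den; field.
  have s3_2 : sqrt3 <= 2.
    by rewrite -(@ler_pXn2r _ 2) ?nnegrE ?(ltW sqrt3_gt0)// sqrt3_sq; lra.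
  rewrite normrM (ger0_norm (ltW sqrt3_gt0)).
  rewrite (@le_trans _ _ (2 * (1 / 6)))//; last by lra.
  by apply: ler_pM => //; [exact: ltW|apply: abs_le; lra].
have p2_le : `|p 0 2| <= 1.
  rewrite P3_P -/i -(@ler_pXn2r _ 2) ?nnegrE// real_normK ?num_real// expr1n; lra.
have S_sum : (x 0 0 + p 0 0) ^+ 2 <= 9.
  have s3' : `|x 0 0 + p 0 0| <= 3.
    rewrite (_ : _ + _ = (x 0 0 - p 0 0) + 2 * p 0 0); last by ring.
    by rewrite (le_trans (ler_normD _ _))// normrM (@ger0_norm _ 2)//; lra.
  rewrite -(real_normK (num_real _)).
  by rewrite (_ : 9 = 3 ^+ 2) ?ler_sqr ?nnegrE//; ring.
have P_sum : (x 0 2 + p 0 2) ^+ 2 <= 9.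
  have s3' : `|x 0 2 + p 0 2| <= 3.
    rewrite (_ : _ + _ = (x 0 2 - p 0 2) + 2 * p 0 2); last by ring.
    by rewrite (le_trans (ler_normD _ _))// normrM (@ger0_norm _ 2)//; lra.
  rewrite -(real_normK (num_real _)).
  by rewrite (_ : 9 = 3 ^+ 2) ?ler_sqr ?nnegrE//; ring.
(* D is a sum of three terms, so D^2 <= 3 (z^2 + s^2 + t^2 / 4) <= 3 (1 + 45 + 18 / 4) q, which is
   below 153 q; the factor l^2 / 2 in D is at least 1. *)
have W_q : (x 0 1 ^+ 2 - U3 ^+ 2) ^+ 2 <= 153 * q.
  pose D := l ^+ 2 / 2 * (x 0 1 ^+ 2 - U3 ^+ 2).
  pose s := (x 0 0 - p 0 0) * (x 0 0 + p 0 0).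
  pose t := (x 0 2 - p 0 2) * (x 0 2 + p 0 2).
  have DE : D = - zco x - s - t / 2.
    by rewrite /D /s /t -[zco x]subr0 -zco_P3 /zco -/U3; field.
  have D_ge : (x 0 1 ^+ 2 - U3 ^+ 2) ^+ 2 <= D ^+ 2.
    rewrite /D exprMn ler_peMl ?sqr_ge0// exprn_ege1//; lra.
  have s_q : s ^+ 2 <= 45 * q.
    rewrite /s exprMn (@le_trans _ _ (5 * q * 9))//; last by lra.
    by apply: ler_pM; rewrite ?sqr_ge0.
  have t_q : t ^+ 2 <= 18 * q.
    rewrite /t exprMn (@le_trans _ _ (2 * q * 9))//; last by lra.
    by apply: ler_pM; rewrite ?sqr_ge0.
  have z_q : zco x ^+ 2 <= q by rewrite /q; lra.
  apply: le_trans D_ge _; rewrite DE; clear DE.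
  move: (zco x) (s) (t) z_q s_q t_q => Z s' t' z_q s_q t_q.
  have := sqr_ge0 (Z - s'); have := sqr_ge0 (Z - t' / 2); have := sqr_ge0 (s' - t' / 2).
  nra.
(* The tolerance [U3] on the second coordinate was chosen for this: then U + [U3] >= [U3], and U^2 -
   [U3]^2 can be divided by it. *)
have x1_ge0 : 0 <= x 0 1.
  have hU' : `|x 0 1 - U3| <= U3 := hU.
  by move: hU'; rewrite ler_norml => /andP[+ _]; rewrite lerBrDr addNr.
have U_q : (x 0 1 - p 0 1) ^+ 2 <= 153 / U3 ^+ 2 * q.
  rewrite mulrAC ler_pdivlMr ?exprn_gt0// (le_trans _ W_q)//.
  rewrite (_ : (x 0 1 ^+ 2 - _) ^+ 2 = (x 0 1 - U3) ^+ 2 * (x 0 1 + U3) ^+ 2); last by ring.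
  rewrite ler_wpM2l ?sqr_ge0// ler_sqr ?nnegrE ?(ltW U3_gt0)//.
  1,2: by rewrite ?lerDr ?addr_ge0 ?(ltW U3_gt0).
have q0 : 0 <= q by rewrite /q; lra.
have c0 : 0 <= 153 / U3 ^+ 2 * q.
  by rewrite mulr_ge0// divr_ge0// exprn_ge0// ltW.
rewrite -/q; set B := _ * q.
have B0 : 0 <= B by rewrite /B; lra.
suff : `|x - p| <= Num.sqrt B.
  by rewrite -(@ler_pXn2r _ 2) ?nnegrE ?sqrtr_ge0// sqr_sqrtr.
have coord_le (u : R) : u ^+ 2 <= B -> `|u| <= Num.sqrt B.
  by move=> uB; rewrite -sqrtr_sqr ler_wsqrtr.
apply: norm_le_coord; first exact: sqrtr_ge0.
move=> i' j; rewrite ord1 [X in `|X|]mxE [X in `|_ + X|]mxE; apply: coord_le.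
have [->|->|->] := ord3P j.
- by apply: (le_trans S_q); rewrite /B; lra.
- by apply: (le_trans U_q); rewrite /B; lra.
- by apply: (le_trans P_q); rewrite /B; lra.
Qed.

Lemma asymptotically_stable_sink : 2 < l ^+ 2 ->
  asymptotically_stable (SUP_field l) (P3 l).
Proof.
move=> l2; pose d := (l ^+ 2 - 2) * (l ^+ 2 + 2) / (4 * den ^+ 2).
have d0 : 0 < d by rewrite divr_gt0 ?mulr_gt0 ?exprn_gt0//; lra.
(* The upper bound is where l^2 > 2 enters: [rate] equals 1/2 + 1 / (2 [den]) with [den] > 3. *)
have tau_itv : 1 / 2 <= rate <= 2 / 3.
  by rewrite rate_ge_half/= /rate ler_pdivrMr ?mulr_gt0// /den; lra.
have dt : 0 < d <= rate ^+ 2.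
  rewrite d0/= -subr_ge0 (_ : _ - _ = (l ^+ 2 + 2) / den ^+ 2); last first.
    by rewrite /d /rate /den; field.
  by rewrite divr_ge0// ?exprn_ge0 ?(ltW den_gt0)//; lra.
pose Y := quadco 1 rate (d * rate / 2) (- (d / 2)) 0.
have dY x : differentiable Y x by exact: differentiable_quadco.
have Yp : Y p = 0 by rewrite /Y /quadco yco_P3 zco_P3 Gco_P3; ring.
have YE x : Y x = yco x ^+ 2 + rate * zco x ^+ 2 + d * rate / 2 * Gco x ^+ 2
    - d / 2 * (Gco x * zco x).
  by rewrite /Y /quadco; ring.
have e0 : 0 < d / 160 by lra.
have [r1 r10 h1] := near_coefficients e0.
have [C C0 [r2 r20 h2]] := coordinates_control l2.
have [L L0 clip_lip] := clipped_lipschitz.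
have d8 : 0 < d / 8 by lra.
have d80 : 0 < d / 80 by lra.
(* The factor d / 8 comes from the lower bound in [sink_bounds], and the decay rate d / 80 is d / 40
   over its upper factor 2. Radius at most 1 keeps the clipping inactive. *)
apply: (@lyapunov_asymptotically_stable _ _ Y p dY (SUP_field l)
  (SUP_field l \o clipped) (C / (d / 8)) (d / 80) (Num.min 1 (Num.min r1 r2))) => //.
- by rewrite divr_ge0// ltW.
- by rewrite !lt_min ltr01 r10.
- move=> x; rewrite !lt_min => /and3P[x1 /h1[ha hk hw] /h2 hC].
  have {}hw : `|Wco x + d| <= d / 160.
    by apply: le_trans hw; rewrite /d le_eqVlt; apply/orP; left; apply/eqP;
      congr (`|_|); rewrite /den; field.
  have est := sink_estimate (yco x) (Gco x) (zco x) tau_itv dt erefl ha hk hw.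
  have DY : 'D_(SUP_field l x) Y x =
      2 * yco x * (kappa x * yco x) + rate * (2 * zco x * (aco x * zco x + Wco x * Gco x))
      + d * rate / 2 * (2 * Gco x * (kappa x * Gco x + 2 * zco x))
      - d / 2 * ((kappa x * Gco x + 2 * zco x) * zco x + Gco x * (aco x * zco x + Wco x * Gco x)).
    by rewrite derive_quadco; ring.
  rewrite -DY in est.
  have /andP[lo up] := sink_bounds (yco x) (Gco x) (zco x) tau_itv dt.
  rewrite -YE in lo up.
  split; last by rewrite /= clip_id.
  + apply: (le_trans hC); rewrite -mulrA ler_wpM2l//.
    by rewrite mulrC ler_pdivlMr// mulrC.
  + apply: (le_trans est); rewrite !mulNr lerN2.
    apply: (le_trans (ler_wpM2l (ltW d80) up)).
    by rewrite le_eqVlt; apply/orP; left; apply/eqP; field.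
- by move=> x0; apply: (lipschitz_global_solution L0).
Qed.

End SUPSystem.

(** * Assembly of the cases *)

Theorem mainTheorem7 (R : realType) (l : R) (hl : 0 <= l) :
  let f := SUP_field l in
  let A := linearization f (P3 l) in
  let eigs := [:: eps1 l; eps2 l; eps3 l] in
  [/\ f (P3 l) = 0,
      (forall z : complex R, eigenvalue A z = (z \in eigs)) /\
        char_poly A = \prod_(z <- eigs) ('X - z%:P),
      l <= Num.sqrt 2 -> unstable f (P3 l)
    & Num.sqrt 2 < l -> asymptotically_stable f (P3 l)].
Proof.
move=> f A eigs.
have s2 : Num.sqrt 2 ^+ 2 = 2 :> R by rewrite sqr_sqrtr.
split; first exact: SUP_field_P3.
- split; first exact: eigenvalue_linearization.
  exact: char_poly_linearization.
(* At l = sqrt 2 the product [det23] vanishes and the linearization does not decide, hence the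
   separate center argument. *)
- rewrite le_eqVlt => /orP[/eqP l_eq|l_lt].
    by apply: unstable_center => //; rewrite l_eq.
  apply: unstable_saddle => //.
  by rewrite -s2 ltr_pXn2r// nnegrE sqrtr_ge0.
- move=> l_gt; apply: asymptotically_stable_sink.
  by rewrite -s2 ltr_pXn2r// nnegrE sqrtr_ge0.
Qed.
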